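(* Let $\epsilon>0$ be any constant and let $k\leq(1-\epsilon)\log_2 n$. Then there exists a function $F:(\{0,1\}^n)^{k+1}\to\{-1,+1\}$ such that, in the $(k+1)$-party number-on-forehead model, \[N(F)=O(\log n)\qquad\text{and}\qquad \mathit{MA}(-F)=n^{\Omega(1)}.\] In particular, $\mathsf{coNP}_k^{cc}\not\subseteq\mathsf{MA}_k^{cc}$ and $\mathsf{NP}_k^{cc}\neq\mathsf{coNP}_k^{cc}$.
   Context: Boolean functions take values in $\{-1,+1\}$, with $-1$ meaning ''true''. In the number-on-forehead model with players $1,\dots,k$ the input $(x_1,\dots,x_k)$ is distributed so that player $i$ sees every $x_j$ with $j\neq i$; players write bits on a shared blackboard. For $G$, $N(G)$ is the least cost $c_1+c_2$ of a nondeterministic protocol ($c_1$ nondeterministic bits, then $c_2$ deterministic bits), correct for at least one nondeterministic choice when $G=-1$ and for all choices when $G=+1$. $\mathit{MA}(G)$ is the least cost $c_1+c_2$ of a Merlin-Arthur protocol: $c_1$ nondeterministic bits followed by $c_2$ bits of public-coin randomized communication, with error probability at most $1/3$ for at least one nondeterministic choice when $G=-1$ and for all choices when $G=+1$. $\mathsf{NP}_k^{cc},\mathsf{coNP}_k^{cc},\mathsf{MA}_k^{cc}$ are the classes of functions $G:(\{0,1\}^n)^k\to\{-1,+1\}$ with $N(G)$, $N(-G)$, $\mathit{MA}(G)$ respectively at most $\log^{O(1)}n$. *)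

(* Defs.v *)
From mathcomp Require Import all_boot all_order all_algebra.
From mathcomp Require Import all_classical all_reals all_analysis.

Set Implicit Arguments.
Unset Strict Implicit.
Unset Printing Implicit Defensive.

Import Order.TTheory GRing.Theory Num.Theory.
Local Open Scope ring_scope.
Local Open Scope classical_set_scope.

Definition input (k n : nat) : Type := {ffun 'I_k -> n.-tuple bool}.

(* The values -1 ("true") and +1 are encoded by [true] and [false]; thus the
   function -G is the pointwise Boolean negation of G. *)
Definition boolfun (k n : nat) : Type := input k n -> bool.

Definition negf (k n : nat) (G : boolfun k n) : boolfun k n := fun x => ~~ G x.

(* What player i sees: every x_j with j != i. *)
Definition view (k n : nat) (i : 'I_k) : Type :=
  {ffun {j : 'I_k | j != i} -> n.-tuple bool}.

Definition see (k n : nat) (i : 'I_k) (x : input k n) : view n i :=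
  [ffun j : {j : 'I_k | j != i} => x (val j)].

(* Deterministic number-on-forehead protocol tree.  A node corresponds to the
   contents of the blackboard, which determine who speaks next; at [Say i f P Q]
   player i writes the bit [f v], where v is the view of i, and the protocol
   goes on with P if that bit is [true] and with Q otherwise. *)
Inductive protocol (k n : nat) : Type :=
| Output of bool
| Say (i : 'I_k) of (view n i -> bool) & protocol k n & protocol k n.

Fixpoint run (k n : nat) (P : protocol k n) (x : input k n) : bool :=
  match P with
  | Output b => b
  | Say i f P1 P0 => if f (see i x) then run P1 x else run P0 x
  end.

Fixpoint cost (k n : nat) (P : protocol k n) : nat :=
  match P with
  | Output _ => 0%N
  | Say _ _ P1 P0 => (maxn (cost P1) (cost P0)).+1
  end.

(* Public-coin protocol: a probability distribution over deterministic
   protocols.  A finite coin space with arbitrary real weights is no loss of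
   generality, as there are finitely many trees of any given cost. *)
Record rand_protocol (R : realType) (k n : nat) := RandProtocol {
  coins : finType;
  weight : coins -> R;
  weight_ge0 : forall r, 0 <= weight r;
  weight_sum1 : \sum_r weight r = 1;
  det_of : coins -> protocol k n
}.

Arguments weight {R k n} _ _.
Arguments det_of {R k n} _ _.

Definition error (R : realType) (k n : nat) (P : rand_protocol R k n)
    (G : boolfun k n) (x : input k n) : R :=
  \sum_(r : coins P | run (det_of P r) x != G x) weight P r.

(* A choice of the c1 nondeterministic bits is a string w, visible to all. *)
Definition nondet_computes (k n c1 : nat)
    (P : c1.-tuple bool -> protocol k n) (G : boolfun k n) : Prop :=
  forall x, if G x then exists w, run (P w) x = G x
            else forall w, run (P w) x = G x.

Definition MA_computes (R : realType) (k n c1 : nat)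
    (P : c1.-tuple bool -> rand_protocol R k n) (G : boolfun k n) : Prop :=
  forall x, if G x then exists w, error (P w) G x <= 3^-1
            else forall w, error (P w) G x <= 3^-1.

Definition nondet_costs (k n : nat) (G : boolfun k n) : set nat :=
  [set c | exists c1 c2 : nat, c = (c1 + c2)%N /\
     exists P : c1.-tuple bool -> protocol k n,
       (forall w, (cost (P w) <= c2)%N) /\ nondet_computes P G].

Definition MA_costs (R : realType) (k n : nat) (G : boolfun k n) : set nat :=
  [set c | exists c1 c2 : nat, c = (c1 + c2)%N /\
     exists P : c1.-tuple bool -> rand_protocol R k n,
       (forall w r, (cost (det_of (P w) r) <= c2)%N) /\ MA_computes P G].

(* The least cost, +oo when there is no protocol (which can happen
   only with a single player). *)
Definition least_cost (R : realType) (A : set nat) : \bar R :=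
  ereal_inf [set (c%:R)%:E | c in A].

Definition Ncc (R : realType) (k n : nat) (G : boolfun k n) : \bar R :=
  least_cost R (nondet_costs G).

Definition MAcc (R : realType) (k n : nat) (G : boolfun k n) : \bar R :=
  least_cost R (MA_costs R G).

Definition log2 (R : realType) (x : R) : R := ln x / ln 2.

(* The number of players may depend on the length n of the inputs. *)
Definition family (k : nat -> nat) : Type := forall n : nat, boolfun (k n) n.

Definition polylog (R : realType) (u : nat -> \bar R) : Prop :=
  exists d : nat, \forall n \near \oo, (u n <= ((log2 (n%:R : R)) ^+ d)%:E)%E.

Definition NP_class (R : realType) (k : nat -> nat) : set (family k) :=
  [set G | polylog (fun n => Ncc R (G n))].

Definition coNP_class (R : realType) (k : nat -> nat) : set (family k) :=
  [set G | polylog (fun n => Ncc R (negf (G n)))].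

Definition MA_class (R : realType) (k : nat -> nat) : set (family k) :=
  [set G | polylog (fun n => MAcc R (G n))].

Arguments NP_class R k _ : clear implicits.
Arguments coNP_class R k _ : clear implicits.
Arguments MA_class R k _ : clear implicits.

(* Main.v *)
(**
Player 0 holds a bit string x; the others jointly select, through a function
phi, a set S of m positions of x, and F says that x has a 1 in S.  Guessing
such a position shows N(F) = O(log n).

For the lower bound, combine the laws Bernoulli(((j-d)/d)^2)^m, j = 0..2d, with
the alternating binomial weights of the finite difference of order 2d.  The
resulting signed measure of norm at most 1 on {0,1}^m annihilates every function
of fewer than d bits, yet gives mass at least 1/(4d+2) to the zero string when
m = d^2(4d+2).  Placed on the bits of x in S it is a density h on the inputs.
By repeated Cauchy-Schwarz over the coordinates other than x, the
correlation of h with a cylinder intersection, to the power K = 2^k, is at most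
the mean over cubes {y^u} of |E_x prod_u h(x, y^u)|.  This vanishes unless each
of the K selected sets meets the union of the others in at least d points, and
is at most 2^(number of coincidences) anyway; for a random phi so many
coincidences are exponentially unlikely as K is below n^(1-eps).  Hence some
phi gives correlation at most 2^(1-d).

Given a Merlin-Arthur protocol for -F with c1 + c2 bits, let A be the sum over
Merlin's messages of the r-th power of the acceptance probability: A is at
least (2/3)^r where F fails and at most 2^(c1) 3^(-r) elsewhere, so for
r = c1 + O(log d) it correlates with h.  As A is a sum of 2^(c1) mixtures of
r-fold products of protocols, its correlation is at most 2^(c1 + r c2 + 1 - d).
Therefore d = O((c1 + log d)(c2 + 1)).
*)
Require Import Defs.
From mathcomp Require Import all_boot all_order all_algebra.
From mathcomp Require Import all_classical all_reals all_analysis.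
From mathcomp Require Import ring lra zify.
Import Order.TTheory GRing.Theory Num.Theory.
Local Open Scope ring_scope.
Local Open Scope classical_set_scope.
Set Implicit Arguments.
Unset Strict Implicit.
Unset Printing Implicit Defensive.

(** * Averages and the discrepancy of cylinder intersections *)

Section Average.
Context {R : realFieldType}.
Implicit Types S T : finType.

Definition avg {T} (f : T -> R) : R := #|T|%:R^-1 * \sum_t f t.

Lemma eq_avg T (f g : T -> R) : f =1 g -> avg f = avg g.
Proof. by move=> fg; rewrite /avg (eq_bigr g). Qed.

Lemma ler_avg T (f g : T -> R) : (forall t, f t <= g t) -> avg f <= avg g.
Proof.
by move=> fg; rewrite ler_wpM2l ?invr_ge0 ?ler0n// ler_sum.
Qed.

Lemma avg_cst T (c : R) : (0 < #|T|)%N -> avg (fun _ : T => c) = c.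
Proof.
move=> T0; rewrite /avg sumr_const -[c *+ _]mulr_natl mulKf//.
by rewrite pnatr_eq0 -lt0n.
Qed.

Lemma avgD T (f g : T -> R) : avg (fun t => f t + g t) = avg f + avg g.
Proof. by rewrite /avg big_split mulrDr. Qed.

Lemma avgZl T (c : R) (f : T -> R) : avg (fun t => c * f t) = c * avg f.
Proof. by rewrite /avg -mulr_sumr mulrCA. Qed.

Lemma avgZr T (c : R) (f : T -> R) : avg (fun t => f t * c) = avg f * c.
Proof. by rewrite /avg -mulr_suml mulrA. Qed.

Lemma avg_sum T (I : Type) (r : seq I) (f : I -> T -> R) :
  avg (fun t => \sum_(i <- r) f i t) = \sum_(i <- r) avg (f i).
Proof. by rewrite /avg exchange_big mulr_sumr. Qed.

Lemma avg_exchange S T (f : S -> T -> R) :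
  avg (fun s => avg (f s)) = avg (fun t => avg (f^~ t)).
Proof.
rewrite /avg; under eq_bigr do rewrite mulr_sumr.
rewrite exchange_big mulr_sumr [RHS]mulr_sumr; apply: eq_bigr => t _.
rewrite -mulr_sumr mulrCA; congr (_ * _).
Qed.

Lemma avg_ge0 T (f : T -> R) : (forall t, 0 <= f t) -> 0 <= avg f.
Proof. by move=> f0; rewrite mulr_ge0 ?invr_ge0 ?ler0n// sumr_ge0. Qed.

Lemma ler_norm_avg T (f : T -> R) : `|avg f| <= avg (fun t => `|f t|).
Proof.
rewrite /avg normrM ger0_norm ?invr_ge0 ?ler0n//.
by rewrite ler_wpM2l ?invr_ge0 ?ler0n// ler_norm_sum.
Qed.

Lemma avg_exists_le T (f : T -> R) : (0 < #|T|)%N -> exists t, f t <= avg f.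
Proof.
move=> T0; case: (pickP (fun t => f t <= avg f)) => [t|no]; first by exists t.
have : \sum_(t : T) avg f < \sum_t f t.
  have /card_gt0P[t0 _] := T0.
  rewrite (bigD1 t0)//= [ltRHS](bigD1 t0)//= ltr_leD//; first by rewrite ltNge no.
  by apply: ler_sum => t _; rewrite ltW// ltNge no.
rewrite sumr_const -[X in X < _]mulr_natl {2}/avg mulrA mulfV ?mul1r ?ltxx//.
by rewrite pnatr_eq0 -lt0n.
Qed.

Lemma sqr_avg_le T (f : T -> R) : avg f ^+ 2 <= avg (fun t => f t ^+ 2).
Proof.
have [T0|] := posnP #|T|; first by rewrite /avg T0 invr0 !mul0r expr0n.
move=> T0; have : 0 <= avg (fun t => (f t - avg f) ^+ 2).
  by apply: avg_ge0 => t; exact: sqr_ge0.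
rewrite (@eq_avg _ _ (fun t => f t ^+ 2 + ((- 2 * avg f) * f t + avg f ^+ 2)));
  last by move=> t; ring.
rewrite !avgD avgZl avg_cst//; nra.
Qed.

Lemma norm_avg_expn2_le T (f : T -> R) j :
  `|avg f| ^+ (2 ^ j) <= avg (fun t => `|f t| ^+ (2 ^ j)).
Proof.
elim: j f => [|j IH] f; first by rewrite !expr1 ler_norm_avg.
rewrite expnS exprM -normrX.
have : `|avg f ^+ 2| <= avg (fun t => `|f t ^+ 2|).
  rewrite ger0_norm ?sqr_ge0//; apply: (le_trans (sqr_avg_le f)).
  by apply: ler_avg => t; exact: ler_norm.
move=> h; apply: (le_trans (lerXn2r _ _ _ h)); rewrite ?nnegrE//.
  by apply: avg_ge0.
rewrite -[X in X ^+ _]ger0_norm; last exact: avg_ge0.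
apply: (le_trans (IH _)); apply: ler_avg => t.
by rewrite normr_id normrX exprM.
Qed.

End Average.

Section Cauchy_Schwarz.
Context {R : realFieldType} {I T : finType}.
Hypothesis T_gt0 : (0 < #|T|)%N.
Implicit Types (z : {ffun I -> T}) (i : I) (t : T).

Definition upd z i t : {ffun I -> T} := [ffun j => if j == i then t else z j].

Lemma upd_id z i : upd z i (z i) = z.
Proof. by apply/ffunP => j; rewrite ffunE; case: eqP => // ->. Qed.

Lemma updK z i t t' : upd (upd z i t) i t' = upd z i t'.
Proof. by apply/ffunP => j; rewrite !ffunE; case: eqP. Qed.

Lemma upd_same z i t : upd z i t i = t.
Proof. by rewrite ffunE eqxx. Qed.

Lemma upd_other z i t j : j != i -> upd z i t j = z j.
Proof. by rewrite ffunE => /negPf->. Qed.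

Lemma updC z i j t t' : i != j ->
  upd (upd z i t) j t' = upd (upd z j t') i t.
Proof.
move=> ij; apply/ffunP => l; rewrite !ffunE.
by case: (eqVneq l j) => // ->; rewrite eq_sym (negPf ij).
Qed.

Lemma card_ffun_gt0 : (0 < #|{ffun I -> T}|)%N.
Proof. by rewrite card_ffun expn_gt0 T_gt0. Qed.

(* [(z, t) |-> (upd z i t, z i)] is an involution. *)
Lemma avg_resample i (F : {ffun I -> T} -> R) :
  avg F = avg (fun z => avg (fun t => F (upd z i t))).
Proof.
pose h (u : {ffun I -> T} * T) := (upd u.1 i u.2, u.1 i).
have hK : involutive h.
  by move=> [z t]; rewrite /h /= updK upd_id upd_same.
rewrite /avg; congr (_ * _).
rewrite -mulr_sumr pair_bigA /=.
rewrite (reindex h) /=; last by exists h => u _; exact: hK.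
under [in RHS]eq_bigr do rewrite /h /= updK upd_id.
rewrite -(pair_bigA _ (fun z (t : T) => F z)) /=.
under [in RHS]eq_bigr do rewrite sumr_const -mulr_natl.
by rewrite -mulr_sumr mulKf// pnatr_eq0 -lt0n.
Qed.

(** As [a] ignores coordinate i, [b] may be replaced by its mean over that coordinate. Jensen then
    drops [a], and the square of the mean is an average over two independent copies of the
    coordinate. *)
Lemma avg_cauchy_schwarz i (a b : {ffun I -> T} -> R) :
  (forall z t, a (upd z i t) = a z) -> (forall z, `|a z| <= 1) ->
  avg (fun z => a z * b z) ^+ 2 <=
  avg (fun z => avg (fun t => b z * b (upd z i t))).
Proof.
move=> ai a1; pose B z := avg (fun t => b (upd z i t)).
have BE z t : B (upd z i t) = B z by apply: eq_avg => t'; rewrite updK.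
have -> : avg (fun z => a z * b z) = avg (fun z => a z * B z).
  rewrite (avg_resample i); apply: eq_avg => z; rewrite -avgZl.
  by apply: eq_avg => t; rewrite ai.
apply: (le_trans (sqr_avg_le _)).
have -> : avg (fun z => avg (fun t => b z * b (upd z i t))) =
    avg (fun z => B z ^+ 2).
  transitivity (avg (fun z => b z * B z)).
    by apply: eq_avg => z; rewrite avgZl.
  rewrite (avg_resample i); apply: eq_avg => z; rewrite expr2.
  rewrite -[in RHS](avgZr (B z)); apply: eq_avg => t.
  by rewrite BE.
apply: ler_avg => z; rewrite exprMn ler_piMl ?sqr_ge0//.
by rewrite -real_normK ?num_real// expr_le1.
Qed.

(* One entry for each subset of [l]: entries are repeated when [z0] and [z1]
   agree somewhere on [l]. *)
Fixpoint cube (l : seq I) z0 z1 : seq {ffun I -> T} :=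
  if l is i :: l' then cube l' z0 z1 ++ cube l' (upd z0 i (z1 i)) z1
  else [:: z0].

Lemma size_cube l z0 z1 : size (cube l z0 z1) = (2 ^ size l)%N.
Proof.
elim: l z0 => //= i l IH z0.
by rewrite size_cat !IH expnS mul2n addnn.
Qed.

Lemma cube_updl l z0 z1 i t : i \notin l ->
  cube l (upd z0 i t) z1 = [seq upd p i t | p <- cube l z0 z1].
Proof.
elim: l z0 => //= j l IH z0; rewrite in_cons negb_or => /andP[ij il].
by rewrite map_cat !IH// updC// IH.
Qed.

Lemma cube_updr l z0 z1 i t : i \notin l ->
  cube l z0 (upd z1 i t) = cube l z0 z1.
Proof.
elim: l z0 => //= j l IH z0; rewrite in_cons negb_or => /andP[ij il].
by rewrite !IH// upd_other// eq_sym.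
Qed.

Lemma mem_cube_notin l z0 z1 p i : i \notin l -> p \in cube l z0 z1 ->
  p i = z0 i.
Proof.
elim: l z0 => /= [|j l IH] z0; first by rewrite inE => _ /eqP->.
rewrite in_cons negb_or => /andP[ij il]; rewrite mem_cat => /orP[/IH->//|].
by move=> /IH->//; rewrite upd_other.
Qed.

Lemma uniq_cube l z0 z1 : uniq l -> {in l, forall i, z0 i != z1 i} ->
  uniq (cube l z0 z1).
Proof.
elim: l z0 => //= i l IH z0 /andP[il ul] ne.
have nel j : j \in l -> z0 j != z1 j by move=> jl; rewrite ne// inE jl orbT.
rewrite cat_uniq IH//= IH ?andbT//; last first.
  move=> j jl; rewrite upd_other ?nel//.
  by apply: contraNneq il => <-.
apply/hasPn => p pc; apply: contraTN pc => pc; apply: contraTN isT => pc'.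
have := ne i; rewrite inE eqxx => /(_ isT).
by rewrite -(mem_cube_notin il pc) (mem_cube_notin il pc') upd_same eqxx.
Qed.

(** Each i in [l] costs one Cauchy-Schwarz step: it removes [chi i] and doubles H into
    [H z * H (upd z i t)], while the doubled [chi j] are still cylinders. Once only o is left,
    [chi o] is constant in the innermost variable and drops out under the absolute value. *)
Lemma cylinder_discrepancy (o : I) (l : seq I) (H : {ffun I -> T} -> R)
    (chi : I -> {ffun I -> T} -> R) :
  uniq (o :: l) ->
  (forall i z, `|chi i z| <= 1) ->
  {in o :: l, forall i z t, chi i (upd z i t) = chi i z} ->
  `|avg (fun z => H z * \prod_(i <- o :: l) chi i z)| ^+ (2 ^ size l) <=
  avg (fun z0 => avg (fun z1 =>
    `|avg (fun t => \prod_(p <- cube l z0 z1) H (upd p o t))|)).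
Proof.
elim: l H chi => [|i l IH] H chi ul chi1 chiE.
  rewrite expr1 (avg_resample o); apply: (le_trans (ler_norm_avg _)).
  apply: ler_avg => z; rewrite /= avg_cst ?card_ffun_gt0//.
  rewrite (@eq_avg _ _ _ (fun t => H (upd z o t) * chi o z)); last first.
    by move=> t; rewrite big_seq1 chiE// inE.
  rewrite avgZr normrM [in leRHS](@eq_avg _ _ _ (fun t => H (upd z o t))).
    by rewrite ler_piMr.
  by move=> t; rewrite big_seq1.
have /= := ul; rewrite inE negb_or => /andP[/andP[oi ol] /andP[il ul']].
pose f z := H z * \prod_(j <- o :: l) chi j z.
have E z : H z * \prod_(j <- [:: o, i & l]) chi j z = chi i z * f z.
  by rewrite /f !big_cons; ring.
rewrite (eq_avg E) /= expnS exprM real_normK ?num_real//.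
pose g t := avg (fun z => f z * f (upd z i t)).
have h : avg (fun z => chi i z * f z) ^+ 2 <= avg g.
  rewrite /g avg_exchange; apply: avg_cauchy_schwarz => // z t.
  by rewrite chiE// !inE eqxx orbT.
apply: (le_trans (lerXn2r _ _ _ (le_trans h (ler_norm _)))).
- by rewrite nnegrE sqr_ge0.
- by rewrite nnegrE.
apply: (le_trans (norm_avg_expn2_le _ _)).
pose Ht t z := H z * H (upd z i t).
pose chit t j z := chi j z * chi j (upd z i t).
apply: (le_trans (y := avg (fun t => avg (fun z0 => avg (fun z1 =>
    `|avg (fun u => \prod_(p <- cube l z0 z1) Ht t (upd p o u))|))))).
  apply: ler_avg => t.
  have -> : g t = avg (fun z => Ht t z * \prod_(j <- o :: l) chit t j z).
    by apply: eq_avg => z; rewrite /f /Ht /chit big_split mulrACA.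
  apply: IH; first by rewrite /= ol ul'.
    by move=> j z; rewrite normrM mulr_ile1.
  move=> j jl z t'; have ji : j != i.
    by apply: contraTneq jl => ->; rewrite inE negb_or eq_sym oi.
  have jl' : j \in [:: o, i & l].
    by move: jl; rewrite !inE => /orP[->|->]; rewrite ?orbT.
  by rewrite /chit [X in _ * chi j X]updC// !chiE.
rewrite avg_exchange; apply: ler_avg => z0.
rewrite [leRHS](avg_resample i) avg_exchange; apply: ler_avg => z1.
apply: ler_avg => t; rewrite le_eqVlt; apply/orP; left; apply/eqP.
congr `| _ |; apply: eq_avg => u.
rewrite /= upd_same cube_updl// !cube_updr// big_cat big_map big_split /=.
congr (_ * _); apply: eq_bigr => p _; by rewrite updC.
Qed.

End Cauchy_Schwarz.

(** * Signed product densities on overlapping sets of bits *)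

Section Dups.
Context {T : eqType}.
Implicit Types (a : T) (s : seq T).

Definition dups s : nat := (size s - size (undup s))%N.

Lemma dups_cons a s : dups (a :: s) = ((a \in s) + dups s)%N.
Proof.
rewrite /dups /=; case: ifP => _ /=; last by rewrite subSS.
by rewrite subSn ?size_undup.
Qed.

Lemma perm_dups s1 s2 : perm_eq s1 s2 -> dups s1 = dups s2.
Proof.
move=> s12; rewrite /dups (perm_size s12); congr (_ - _)%N.
by apply/perm_size/perm_undup/perm_mem.
Qed.

Lemma dups_uniq s : uniq s -> dups s = 0%N.
Proof. by move=> us; rewrite /dups undup_id// subnn. Qed.

Lemma dups_le_size s : (dups s <= size s)%N.
Proof. exact: leq_subr. Qed.

(** A value of multiplicity c >= 2 counts c times on the left and c - 1 times in [dups], and c <= 2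
    (c - 1). *)
Lemma count_repeated_le s :
  (count (fun a => 1 < count_mem a s)%N s <= 2 * dups s)%N.
Proof.
elim: s => [|a s IH] //; rewrite dups_cons.
have h : (count (fun b => 1 < count_mem b (a :: s))%N s <=
    count (fun b => 1 < count_mem b s)%N s + (a \in s))%N.
  have [as1|as1] := leqP (count_mem a s) 1%N.
    have -> : ((a \in s) = count_mem a s :> nat)%N.
      by move: as1; rewrite -has_pred1 has_count; case: (count_mem a s) => [|[]].
    rewrite -count_predUI; apply: leq_trans (leq_addr _ _).
    apply: sub_count => b /=; rewrite [b == a]eq_sym.
    by case: (a == b); rewrite ?orbT// orbF add0n.
  apply: leq_trans (leq_addr _ _); apply: sub_count => b /=.
  by case: (eqVneq a b) => [<-|].
have -> : count (fun b => 1 < count_mem b (a :: s))%N (a :: s) =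
    ((a \in s) + count (fun b => 1 < count_mem b (a :: s))%N s)%N.
  by rewrite /= eqxx add1n ltnS -has_count has_pred1.
lia.
Qed.

End Dups.

Section Densities.
Context {R : realFieldType} {n : nat}.
Implicit Types (x : n.-tuple bool) (p : 'I_n).

Definition flip p x : n.-tuple bool := [tuple tnth x i (+) (i == p) | i < n].

Lemma flipK p : involutive (flip p).
Proof. by move=> x; apply: eq_from_tnth => i; rewrite !tnth_mktuple addbK. Qed.

Lemma tnth_flip p x : tnth (flip p x) p = ~~ tnth x p.
Proof. by rewrite tnth_mktuple eqxx addbT. Qed.

Lemma tnth_flip_other p q x : q != p -> tnth (flip p x) q = tnth x q.
Proof. by move=> /negPf qp; rewrite tnth_mktuple qp addbF. Qed.

(** Relative to the uniform measure, [2 * w] is the density of one bit of law w; flipping bit p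
    pairs its two values, which average to 1. *)
Lemma avg_bit_density p (w : bool -> R) (G : n.-tuple bool -> R) :
  w true + w false = 1 -> (forall x, G (flip p x) = G x) ->
  avg (fun x => 2 * w (tnth x p) * G x) = avg G.
Proof.
move=> w1 GE; have e : avg (fun x => w (tnth x p) * G x) =
    avg (fun x => w (~~ tnth x p) * G x).
  rewrite /avg (reindex_inj (inv_inj (flipK p))) /=; congr (_ * _).
  by apply: eq_bigr => x _; rewrite tnth_flip GE.
transitivity (avg (fun x => w (tnth x p) * G x + w (~~ tnth x p) * G x)).
  rewrite avgD -e -mulr2n -[RHS]mulr_natl -avgZl.
  by apply: eq_avg => x; rewrite mulrA.
apply: eq_avg => x; rewrite -mulrDl; case: (tnth x p) => /=.
  by rewrite w1 mul1r.
by rewrite addrC w1 mul1r.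
Qed.

Lemma avg_bits_density (s : seq 'I_n) (w : bool -> R) (G : n.-tuple bool -> R) :
  w true + w false = 1 -> uniq s ->
  {in s, forall p x, G (flip p x) = G x} ->
  avg (fun x => (\prod_(p <- s) (2 * w (tnth x p))) * G x) = avg G.
Proof.
move=> w1; elim: s => [_ _|p s IH /= /andP[ps us] GE].
  by apply: eq_avg => x; rewrite big_nil mul1r.
rewrite -[RHS]IH//; last by move=> q qs x; rewrite GE// inE qs orbT.
rewrite -[RHS](@avg_bit_density p w)//.
  by apply: eq_avg => x; rewrite big_cons mulrA.
move=> x; rewrite GE ?mem_head//; congr (_ * _).
rewrite big_seq [RHS]big_seq; apply: eq_bigr => q qs; rewrite tnth_flip_other//.
by apply: contraTneq qs => ->.
Qed.

Context {J : finType} (w : J -> bool -> R) (b : J -> R).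
Hypothesis w_ge0 : forall j c, 0 <= w j c.
Hypothesis w_sum : forall j, w j true + w j false = 1.
Hypothesis b_norm : \sum_j `|b j| <= 1.

(** Bits are integrated out from the head of the list: at a fresh position the factor averages to 1,
    at a repeated one it is at most 2. *)
Lemma avg_bits_le (l : seq ('I_n * J)) :
  avg (fun x => \prod_(e <- l) (2 * w e.2 (tnth x e.1))) <=
  2 ^+ dups (map fst l).
Proof.
elim: l => [|[p j] l IH].
  rewrite (@eq_avg _ _ _ (fun _ => 1)); last by move=> x; rewrite big_nil.
  by rewrite avg_cst// card_tuple expn_gt0 card_bool.
rewrite (@eq_avg _ _ _
  (fun x => 2 * w j (tnth x p) * \prod_(e <- l) (2 * w e.2 (tnth x e.1))));
  last by move=> x; rewrite big_cons.
have P0 x : 0 <= \prod_(e <- l) (2 * w e.2 (tnth x e.1)).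
  by apply: prodr_ge0 => e _; rewrite mulr_ge0.
rewrite /= dups_cons; have [pl|pl] /= := boolP (p \in map fst l).
  rewrite exprS; apply: le_trans (_ : 2 * avg (fun x =>
      \prod_(e <- l) (2 * w e.2 (tnth x e.1))) <= _); last first.
    by rewrite ler_wpM2l.
  rewrite -avgZl; apply: ler_avg => x; rewrite ler_wpM2r// ler_piMr//.
  have := w_sum j; have := w_ge0 j true; have := w_ge0 j false.
  by case: (tnth x p); lra.
rewrite add0n avg_bit_density// => x.
rewrite big_seq [RHS]big_seq; apply: eq_bigr => e el; rewrite tnth_flip_other//.
by apply: contraNneq pl => <-; exact: map_f.
Qed.

(** For distinct positions, this is the density, relative to the uniform measure, of the signed
    mixture with weights b of product laws on the bits in [row]. *)
Definition density (row : seq 'I_n) x : R :=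
  \sum_j b j * \prod_(p <- row) (2 * w j (tnth x p)).

Lemma norm_density_le row x :
  `|density row x| <= \sum_j `|b j| * \prod_(p <- row) (2 * w j (tnth x p)).
Proof.
apply: (le_trans (ler_norm_sum _ _ _)); apply: ler_sum => j _.
rewrite normrM ler_wpM2l// ger0_norm//.
by apply: prodr_ge0 => e _; rewrite mulr_ge0.
Qed.

(** The list l carries the bits of the rows already expanded, each with its mixture index. The total
    weight of b is at most 1, so summing over the index of a row costs nothing. *)
Lemma avg_prod_norm_density_le_aux (rows : seq (seq 'I_n)) (l : seq ('I_n * J)) :
  avg (fun x => (\prod_(e <- l) (2 * w e.2 (tnth x e.1))) *
                \prod_(row <- rows) `|density row x|) <=
  2 ^+ dups (flatten rows ++ map fst l).
Proof.
elim: rows l => [|row rows IH] l.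
  apply: le_trans (avg_bits_le l); apply: ler_avg => x.
  by rewrite big_nil mulr1.
pose l' j := [seq (p, j) | p <- row] ++ l.
pose W (s : seq ('I_n * J)) x := \prod_(e <- s) (2 * w e.2 (tnth x e.1)).
apply: le_trans (_ : avg (fun x => \sum_j `|b j| *
    (W (l' j) x * \prod_(row <- rows) `|density row x|)) <= _).
  apply: ler_avg => x; rewrite big_cons mulrCA.
  rewrite (eq_bigr (fun j => (`|b j| * \prod_(p <- row) (2 * w j (tnth x p))) *
     (W l x * \prod_(row <- rows) `|density row x|))).
    rewrite -mulr_suml ler_wpM2r ?norm_density_le// mulr_ge0//.
      by apply: prodr_ge0 => e _; rewrite mulr_ge0.
    by apply: prodr_ge0 => e _; exact: normr_ge0.
  by move=> j _; rewrite /W /l' big_cat big_map /= !mulrA.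
rewrite avg_sum; under eq_bigr do rewrite avgZl.
apply: le_trans (_ : \sum_j `|b j| * 2 ^+ dups (flatten (row :: rows) ++ map fst l)
  <= _); last by rewrite -mulr_suml ler_piMl ?exprn_ge0.
apply: ler_sum => j _; rewrite ler_wpM2l//; apply: (le_trans (IH _)).
rewrite (@perm_dups _ _ (flatten (row :: rows) ++ map fst l))//.
rewrite map_cat -map_comp map_id_in// catA perm_cat2r/=.
by rewrite perm_catC.
Qed.

Lemma avg_prod_norm_density_le (rows : seq (seq 'I_n)) :
  avg (fun x => \prod_(row <- rows) `|density row x|) <= 2 ^+ dups (flatten rows).
Proof.
have := avg_prod_norm_density_le_aux rows [::]; rewrite cats0.
by apply: le_trans; apply: ler_avg => x; rewrite big_nil mul1r.
Qed.

Variable d : nat.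
Hypothesis b_orth : forall c : seq bool, (size c < d)%N ->
  \sum_j b j * \prod_(a <- c) (2 * w j a) = 0.

(** Positions of [row] outside the other rows integrate to 1. What remains of [row] sees fewer than
    d bits, so it vanishes at every x by [b_orth]. *)
Lemma avg_prod_density_eq0 row (rows : seq (seq 'I_n)) : uniq row ->
  (size [seq p <- row | p \in flatten rows] < d)%N ->
  avg (fun x => density row x * \prod_(row <- rows) density row x) = 0.
Proof.
move=> urow small; set G := fun x => \prod_(r <- rows) density r x.
set F := flatten rows in small *.
have GE p : p \notin F -> forall x, G (flip p x) = G x.
  move=> pF x; rewrite /G big_seq [RHS]big_seq; apply: eq_bigr => r rr.
  apply: eq_bigr => j _; congr (_ * _).
  rewrite big_seq [RHS]big_seq; apply: eq_bigr => q qr; rewrite tnth_flip_other//.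
  by apply: contraNneq pF => <-; apply/flattenP; exists r.
pose S j x := \prod_(p <- [seq p <- row | p \in F]) (2 * w j (tnth x p)).
pose U j x := \prod_(p <- [seq p <- row | p \notin F]) (2 * w j (tnth x p)).
transitivity (\sum_j avg (fun x => U j x * (b j * S j x * G x))).
  rewrite -avg_sum; apply: eq_avg => x; rewrite mulr_suml; apply: eq_bigr => j _.
  have -> : \prod_(p <- row) (2 * w j (tnth x p)) = S j x * U j x.
    by rewrite /S /U !big_filter (bigID (mem F)).
  by rewrite -/(G x); ring.
rewrite (eq_bigr (fun j => avg (fun x => b j * S j x * G x))); last first.
  move=> j _; apply: avg_bits_density => //; first exact: filter_uniq.
  move=> p; rewrite mem_filter => /andP[pF _] x; rewrite GE//; congr (_ * _ * _).
  rewrite /S big_seq [RHS]big_seq; apply: eq_bigr => q.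
  rewrite mem_filter => /andP[qF _]; rewrite tnth_flip_other//.
  by apply: contraNneq pF => <-.
rewrite -avg_sum (@eq_avg _ _ _ (fun _ => 0)) ?avg_cst//.
  by rewrite card_tuple expn_gt0 card_bool.
move=> x; rewrite -mulr_suml.
have := @b_orth [seq tnth x p | p <- row & p \in F].
rewrite size_map => /(_ small).
under eq_bigr do rewrite big_map.
by rewrite /S => ->; rewrite mul0r.
Qed.

(** Either every row has at least d repeated positions, whence [d * size rows <= 2 * dups], or some
    row shares fewer than d with the rest and the average is 0. The base 32 is the 2 of the trivial
    bound times 16 = 4^2. *)
Lemma norm_avg_prod_density_le (rows : seq (seq 'I_n)) : all uniq rows ->
  `|avg (fun x => \prod_(row <- rows) density row x)| * 4 ^+ (d * size rows) <=
  32 ^+ dups (flatten rows).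
Proof.
move=> urows; set s := flatten rows.
pose P := fun p => (1 < count_mem p s)%N.
have [/allP big|/allPn[row]] := boolP (all (fun row => d <= count P row)%N rows).
  have h : (d * size rows <= 2 * dups s)%N.
    apply: leq_trans (count_repeated_le s).
    rewrite -/P /s count_flatten sumnE big_map -sum1_size big_distrr /=.
    by rewrite big_seq [leqRHS]big_seq leq_sum// => r rr; rewrite muln1 big.
  have -> : 32 = 2 * 16 :> R by ring.
  rewrite exprMn ler_pM ?exprn_ge0//.
    apply: (le_trans (ler_norm_avg _)); apply: le_trans (avg_prod_norm_density_le _).
    by apply: ler_avg => x; rewrite normr_prod.
  have -> : 16 = 4 ^+ 2 :> R by ring.
  by rewrite -exprM ler_weXn2l// ler1n.
rewrite -ltnNge => row_in small.
suff -> : avg (fun x => \prod_(row <- rows) density row x) = 0.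
  by rewrite normr0 mul0r exprn_ge0.
have urow := allP urows _ row_in.
have [r1 [r2 rE]] : exists r1 r2, rows = r1 ++ row :: r2.
  by have /path.splitPr[r1 r2] := row_in; exists r1, r2.
rewrite -[RHS](@avg_prod_density_eq0 row (r1 ++ r2))//.
  apply: eq_avg => x; rewrite rE !big_cat !big_cons /=; ring.
apply: leq_ltn_trans small; rewrite -[leqRHS]size_filter.
apply: uniq_leq_size; first exact: filter_uniq.
move=> p; rewrite !mem_filter => /andP[pF prow]; rewrite prow andbT.
rewrite /P; have /permP-> : perm_eq s (row ++ flatten (r1 ++ r2)).
  by rewrite /s rE !flatten_cat /= perm_catCA.
rewrite count_cat -[(1 < _)%N]/(1 + 1 <= _)%N leq_add//.
  by rewrite -has_count has_pred1.
by rewrite -has_count has_pred1.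
Qed.

End Densities.

(** * Finite differences and the dual measure *)

Lemma leq_bin_central d j : ('C(2 * d, j) <= 'C(2 * d, d))%N.
Proof.
wlog jd : j / (j <= d)%N => [H|].
  have [/H//|dj] := leqP j d; have [j2d|j2d] := leqP j (2 * d).
    by rewrite -bin_sub// H//; lia.
  by rewrite bin_small.
move eN: (d - j)%N => N; elim: N j jd eN => [|N IH] j jd eN.
  by have -> : j = d by lia.
apply: leq_trans (IH j.+1 _ _); [|lia|lia].
rewrite -(@leq_pmul2l j.+1)// mul_bin_left leq_mul2r; apply/orP; right; lia.
Qed.

Section Dual.
Context {R : realFieldType}.

Lemma bernoulli_le (x : R) n : 0 <= x -> 1 + n%:R * x <= (1 + x) ^+ n.
Proof.
move=> x0; elim: n => [|n IH]; first by rewrite mul0r addr0.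
have : 0 <= n%:R :> R by [].
by rewrite exprS -natr1; nra.
Qed.

(** A shift of the argument preserves the degree and the leading coefficient, which cancels in the
    difference. *)
Lemma size_diff_poly_le (q : {poly R}) N :
  (size q <= N.+1)%N -> (size (q - (q \Po ('X + 1%:P)))%R <= N)%N.
Proof.
move=> qN; have [->|q0] := eqVneq q 0.
  by rewrite comp_poly0 subr0 size_poly0.
apply/leq_sizeP => j; rewrite leq_eqVlt => /orP[/eqP<-|Nj]; last first.
  rewrite coefB !nth_default ?subrr ?size_comp_poly2 ?size_XaddC//;
  exact: leq_trans Nj.
rewrite coefB; move: qN; rewrite leq_eqVlt => /orP[/eqP qN|qN]; last first.
  by rewrite !nth_default ?subrr ?size_comp_poly2 ?size_XaddC.
have /monicP := monicXaddC (1 : R).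
have := @lead_coef_comp _ q ('X + 1%:P); rewrite size_XaddC => /(_ isT).
move=> + l1; rewrite l1 expr1n mulr1 !lead_coefE size_comp_poly2 ?size_XaddC//.
by rewrite qN /= => ->; rewrite subrr.
Qed.

(** Up to sign the sum is the N-th finite difference of q at 0. Pascal's rule rewrites it as the
    difference of order N - 1 of q(X) - q(X + 1), whose degree is smaller. *)
Lemma alt_binomial_sum_poly_eq0 (q : {poly R}) N : (size q <= N)%N ->
  \sum_(i < N.+1) (-1) ^+ i * 'C(N, i)%:R * q.[i%:R] = 0.
Proof.
elim: N q => [|N IH] q qN.
  have -> : q = 0 by apply/eqP; rewrite -size_poly_leq0.
  by apply: big1 => i _; rewrite horner0 mulr0.
rewrite -[RHS](IH _ (size_diff_poly_le qN)).
have -> : \sum_(i < N.+1) (-1) ^+ i * 'C(N, i)%:R *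
    (q - (q \Po ('X + 1%:P))).[i%:R] =
  \sum_(i < N.+1) (-1) ^+ i * 'C(N, i)%:R * q.[i%:R] +
  \sum_(i < N.+1) (-1) ^+ i.+1 * 'C(N, i)%:R * q.[i.+1%:R].
  rewrite -big_split; apply: eq_bigr => i _ /=.
  by rewrite hornerD hornerN horner_comp !hornerE exprS -natr1; ring.
rewrite big_ord_recl /= [X in _ = X + _]big_ord_recl /= !bin0.
rewrite -addrA; congr (_ + _).
rewrite (eq_bigr (fun i : 'I_N.+1 => (-1) ^+ i.+1 * 'C(N, i.+1)%:R * q.[i.+1%:R] +
   (-1) ^+ i.+1 * 'C(N, i)%:R * q.[i.+1%:R])); last first.
  by move=> i _; rewrite /bump /= add1n binS natrD; ring.
rewrite big_split; congr (_ + _) => /=.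
by rewrite big_ord_recr /= bin_small// mulr0 mul0r addr0.
Qed.

Variable d : nat.
Hypothesis d_gt0 : (0 < d)%N.

Let dR_neq0 : d%:R != 0 :> R. Proof. by rewrite pnatr_eq0 -lt0n. Qed.

(* [bern j] is the Bernoulli law of mean [((j - d) / d) ^ 2] and [dual] is the
   normalized finite difference of order [2 d] in [j]; it kills the probability
   of any event on fewer than [d] bits, a polynomial in [j] of degree < [2 d]. *)
Definition bern (j : 'I_(2 * d).+1) (c : bool) : R :=
  let t := ((j%:R - d%:R) / d%:R) ^+ 2 in if c then t else 1 - t.

Definition dual (j : 'I_(2 * d).+1) : R :=
  (-1) ^+ (d + j) * 'C(2 * d, j)%:R / 4 ^+ d.

Lemma bern_sum j : bern j true + bern j false = 1.
Proof. by rewrite /bern addrC subrK. Qed.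

Lemma bern_ge0 j c : 0 <= bern j c.
Proof.
have h : `|(j%:R - d%:R) / d%:R| <= 1 :> R.
  rewrite normrM normfV (ger0_norm (ler0n _ _)) ler_pdivrMr ?ltr0n// mul1r.
  have := ltn_ord j; rewrite ltnS -(ler_nat R) natrM => jd.
  have : 0 <= j%:R :> R by []. 
  by rewrite ler_norml => ?; apply/andP; split; lra.
rewrite /bern; case: c; first exact: sqr_ge0.
by rewrite subr_ge0 -real_normK ?num_real// expr_le1.
Qed.

Lemma norm_dual j : `|dual j| = 'C(2 * d, j)%:R / 4 ^+ d.
Proof.
rewrite /dual !normrM normr_sign mul1r normfV !normr_nat.
by rewrite ger0_norm ?exprn_ge0.
Qed.

Lemma sum_norm_dual : \sum_j `|dual j| = 1.
Proof.
under eq_bigr do rewrite norm_dual; rewrite -mulr_suml -natr_sum.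
have -> : (\sum_(j < (2 * d).+1) 'C(2 * d, j) = 4 ^ d)%N.
  transitivity ((1 + 1) ^ (2 * d))%N; last by rewrite expnM.
  by rewrite expnDn; apply: eq_bigr => i _; rewrite !exp1n !muln1.
by rewrite natrX divff// expf_neq0// pnatr_eq0.
Qed.

Lemma dual_orth (c : seq bool) : (size c < d)%N ->
  \sum_j dual j * \prod_(a <- c) (2 * bern j a) = 0.
Proof.
move=> cd; pose t : {poly R} := (d%:R^-1 *: ('X - d%:R%:P)) ^+ 2.
pose f (a : bool) : {poly R} := 2%:P * (if a then t else 1 - t).
have st : (size t <= 3)%N.
  by rewrite /t exprZn (leq_trans (size_scale_leq _ _))// size_exp_XsubC.
have sf a : (size (f a) <= 3)%N.
  rewrite /f mul_polyC (leq_trans (size_scale_leq _ _))//; case: a => //.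
  rewrite (leq_trans (size_polyD _ _))// size_polyN size_poly1 geq_max st.
  by [].
have sp : (size (\prod_(a <- c) f a)%R <= 2 * size c + 1)%N.
  elim: c {cd} => [|a c IH]; first by rewrite big_nil size_poly1.
  rewrite big_cons (leq_trans (size_polyMleq _ _))//=.
  by rewrite -subn1 leq_subLR (leq_trans (leq_add (sf a) IH))//; lia.
(* Each factor is a polynomial in j of degree at most 2, so the product has degree below 2 d. *)
have h : _ = 0 := @alt_binomial_sum_poly_eq0 (\prod_(a <- c) f a) (2 * d) ltac:(lia).
transitivity ((-1) ^+ d / 4 ^+ d * 0 : R); last by rewrite mulr0.
rewrite -[X in _ = _ * X]h mulr_sumr; apply: eq_bigr => j _.
rewrite horner_prod /dual exprD.
rewrite (eq_bigr (fun a => (f a).[j%:R])); first by ring.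
have tE : t.[j%:R] = ((j%:R - d%:R) / d%:R) ^+ 2.
  by rewrite /t horner_exp hornerZ hornerXsubC mulrC.
move=> a _; rewrite /f /bern hornerM hornerC.
by case: a; rewrite ?hornerD ?hornerN ?hornerC tE.
Qed.

(* Under the dual weight the all-zero string keeps inverse-polynomial mass: the
   middle term, [j = d], is the largest of the [2 d + 1] binomial weights, and
   the other Bernoulli laws give the string [m] zeros negligible mass. *)
Lemma dual_zero_mass m : m = (d ^ 2 * (4 * d + 2))%N ->
  (4 * d + 2)%:R^-1 <= \sum_j dual j * bern j false ^+ m.
Proof.
move=> mE; have dlt : (d < (2 * d).+1)%N by lia.
pose jd := Ordinal dlt.
have bd : bern jd false = 1.
  by rewrite /bern /= subrr mul0r expr0n subr0.
have dd : dual jd = `|dual jd|.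
  by rewrite norm_dual /dual /= -signr_odd oddD addbb mul1r.
have big : (2 * d + 1)%:R^-1 <= dual jd.
  rewrite -[leLHS]mul1r ler_pdivrMr ?ltr0n ?addn1// -[leLHS]sum_norm_dual dd mulr_natr.
  rewrite -[X in _ *+ X](card_ord (2 * d).+1) -sumr_const; apply: ler_sum => j _.
  rewrite !norm_dual ler_wpM2r ?invr_ge0 ?exprn_ge0// ler_nat /=.
  exact: leq_bin_central.
(* For j distinct from d the mean is at least 1/d^2, so a bit is 0 with probability at most 1/(1 +
   1/d^2). As m/d^2 = 4 d + 2, Bernoulli's inequality bounds the m-th power. *)
have other j : j != jd -> bern j false ^+ m <= (4 * d + 3)%:R^-1.
  move=> jjd; have jNd : (j != d :> nat)%N.
    by apply: contraNneq jjd => jE; apply/eqP/val_inj.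
  have d2_gt0 : 0 < d%:R ^+ 2 :> R by rewrite exprn_gt0// ltr0n.
  have le1 : bern j false <= (1 + (d%:R ^+ 2)^-1)^-1.
    have h1 : 1 <= (j%:R - d%:R) ^+ 2 :> R.
      have [jd'|dj|] := ltngtP j d; last by move/eqP; rewrite (negPf jNd).
        have : j.+1%:R <= d%:R :> R by rewrite ler_nat.
        by rewrite -natr1; nra.
      have : d.+1%:R <= j%:R :> R by rewrite ler_nat.
      by rewrite -natr1; nra.
    rewrite -[leRHS]mul1r ler_pdivlMr ?addr_gt0 ?invr_gt0//.
    rewrite /bern expr_div_n; set v := (d%:R ^+ 2)^-1.
    have v0 : 0 <= v by rewrite invr_ge0 ltW.
    have : v <= (j%:R - d%:R) ^+ 2 * v by rewrite ler_peMl.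
    nra.
  have pos : 0 < 1 + (d%:R ^+ 2)^-1 :> R by rewrite addr_gt0 ?invr_gt0.
  have pos' : 0 <= (1 + (d%:R ^+ 2)^-1)^-1 :> R by rewrite invr_ge0 ltW.
  apply: (le_trans (lerXn2r m _ _ le1)); rewrite ?nnegrE ?bern_ge0//.
  rewrite exprVn lef_pV2 ?posrE ?ltr0n ?addn_gt0 ?exprn_gt0 ?orbT//.
  apply: (le_trans (y := 1 + m%:R * (d%:R ^+ 2)^-1)); last first.
    by apply: bernoulli_le; rewrite invr_ge0 ltW.
  rewrite mE natrM natrX mulrAC mulfV ?expf_neq0// mul1r nat1r.
  by rewrite ler_nat; lia.
have -> : \sum_j dual j * bern j false ^+ m =
    dual jd + \sum_(j | j != jd) dual j * bern j false ^+ m.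
  by rewrite (bigD1 jd)// bd expr1n mulr1.
have rest : `|\sum_(j | j != jd) dual j * bern j false ^+ m| <= (4 * d + 3)%:R^-1.
  apply: (le_trans (ler_norm_sum _ _ _)).
  apply: le_trans (_ : \sum_(j | j != jd) `|dual j| * (4 * d + 3)%:R^-1 <= _).
    apply: ler_sum => j jjd; rewrite normrM ler_wpM2l// ger0_norm ?exprn_ge0 ?bern_ge0//.
    exact: other.
  rewrite -mulr_suml ler_piMl ?invr_ge0 ?ler0n// -sum_norm_dual.
  by rewrite [leRHS](bigD1 jd)//= lerDr.
have r2 : (4 * d + 3)%:R^-1 <= (4 * d + 2)%:R^-1 :> R.
  by rewrite lef_pV2 ?posrE ?ltr0n ?addnS// ler_nat.
have r3 : (2 * d + 1)%:R^-1 = 2 * (4 * d + 2)%:R^-1 :> R.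
  have -> : (4 * d + 2)%N = (2 * (2 * d + 1))%N by lia.
  by rewrite [in RHS]natrM invfM mulVKf ?pnatr_eq0.
(* The middle term is at least 2/(4 d + 2) and the others remove at most 1/(4 d + 3). *)
by move: rest; rewrite ler_norml => /andP[]; lra.
Qed.

End Dual.

(** * Random selection functions *)

Section Random_positions.
Context {R : realFieldType} {A : finType} {m B n : nat}.
Variable iota : 'I_m * 'I_B -> 'I_n.
Hypothesis iota_inj : injective iota.
Hypothesis B_gt0 : (0 < B)%N.
Implicit Types (phi : {ffun A * 'I_m -> 'I_B}) (L : seq (A * 'I_m)).

Definition positions phi L : seq 'I_n := [seq iota (e.2, phi e) | e <- L].

(** As [iota] is injective, at most N of the B values of t land in s. *)
Lemma avg_collision_le (c : R) (i : 'I_m) (s : seq 'I_n) N : 0 <= c ->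
  (size s <= N)%N ->
  avg (fun t : 'I_B => c ^+ (iota (i, t) \in s)) <= 1 + c * N%:R / B%:R.
Proof.
move=> c0 sN.
apply: (le_trans (y := avg (fun t : 'I_B => 1 + c * (iota (i, t) \in s)%:R))).
  apply: ler_avg => t; case: (_ \in _); rewrite ?mulr1 ?mulr0 ?addr0//.
  by rewrite expr1 lerDr.
rewrite avgD avgZl avg_cst ?card_ord// lerD2l -mulrA ler_wpM2l//.
rewrite /avg card_ord mulrC ler_wpM2r ?invr_ge0 ?ler0n//.
rewrite -natr_sum ler_nat; apply: leq_trans sN.
rewrite -[X in (X <= _)%N]big_mkcond sum1_card cardE.
rewrite -(size_map (fun t => iota (i, t))); apply: uniq_leq_size.
  rewrite map_inj_uniq ?enum_uniq// => t u /iota_inj[].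
  by [].
by move=> p /mapP[t]; rewrite mem_enum => ts ->.
Qed.

(** The values of [phi] are revealed one at a time: at a new point of L the value is uniform and
    independent of the earlier ones, and it creates a coincidence only by hitting one of at most N
    positions. *)
Lemma avg_dups_le (c : R) L N : 0 <= c -> uniq L -> (size L <= N)%N ->
  avg (fun phi => c ^+ dups (positions phi L)) <=
  (1 + c * N%:R / B%:R) ^+ size L.
Proof.
move=> c0; have T0 : (0 < #|'I_B|)%N by rewrite card_ord.
elim: L => [|e L IH].
  by move=> _ _; rewrite (@eq_avg _ _ _ (fun _ => 1)) ?avg_cst ?card_ffun_gt0.
rewrite cons_uniq => /andP[eL uL] LN; rewrite (avg_resample T0 e).
have x0 : 0 <= 1 + c * N%:R / B%:R by rewrite addr_ge0// divr_ge0// mulr_ge0.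
rewrite exprS.
apply: le_trans (_ : avg (fun phi => (1 + c * N%:R / B%:R) *
  c ^+ dups (positions phi L)) <= _); last first.
  by rewrite avgZl ler_wpM2l// IH// ltnW.
apply: ler_avg => phi.
rewrite (@eq_avg _ _ _ (fun t => c ^+ (iota (e.2, t) \in positions phi L) *
    c ^+ dups (positions phi L))).
  rewrite avgZr ler_wpM2r ?exprn_ge0// avg_collision_le// size_map.
  exact: ltnW.
move=> t; have -> : positions (upd phi e t) (e :: L) =
    iota (e.2, t) :: positions phi L.
  rewrite /positions /= upd_same; congr (_ :: _).
  apply/eq_in_map => f fL; rewrite upd_other//.
  by apply: contraNneq eL => <-.
by rewrite dups_cons exprD.
Qed.

End Random_positions.

(** * The density on the inputs and the choice of the selection function *)

Lemma expr1D_le (R : realFieldType) (x : R) m :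
  0 <= x -> m%:R * x <= 2^-1 -> (1 + x) ^+ m <= 1 + 2 * m%:R * x.
Proof.
move=> x0; elim: m => [|m IH]; first by rewrite mulr0 mul0r addr0.
rewrite -natr1 => h; have m0 : 0 <= m%:R :> R by [].
rewrite exprS; have := IH ltac:(nra); nra.
Qed.

Section Lifted_density.
Context {R : realFieldType} {n k d m B : nat}.
Notation input := {ffun 'I_k.+1 -> n.-tuple bool}.
Notation K := (2 ^ k)%N.
Variable iota : 'I_m * 'I_B -> 'I_n.
Hypothesis iota_inj : injective iota.
Hypothesis d_gt0 : (0 < d)%N.
Hypothesis dm : (d <= m)%N.
Hypothesis mB : (m * B <= n)%N.
Hypothesis KB : (64 * K * m ^ 2 <= B)%N.

Let B_gt0 : (0 < B)%N.
Proof.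
by apply: leq_trans KB; rewrite !muln_gt0 !expn_gt0 /= (leq_trans d_gt0).
Qed.

Implicit Types (z : input) (phi : {ffun input * 'I_m -> 'I_B}).

Definition blank z : input := upd z ord0 [tuple false | i < n].

(* Player 0 holds the bit string; the other players select, through [phi], one
   position in each of the [m] blocks [{iota (i, t) | t < B}].  Blanking the
   string of player 0 makes [phi] depend on their inputs only. *)
Definition row phi z : seq 'I_n :=
  [seq iota (i, phi (blank z, i)) | i <- enum 'I_m].

Definition others : seq 'I_k.+1 := [seq lift ord0 i | i <- enum 'I_k].

Definition lifted phi z : R := density (@bern R d) (@dual R d) (row phi z) (z ord0).

Lemma size_row phi z : size (row phi z) = m.
Proof. by rewrite size_map size_enum_ord. Qed.

Lemma uniq_row phi z : uniq (row phi z).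
Proof. by rewrite map_inj_uniq ?enum_uniq// => i j /iota_inj[]. Qed.

Lemma row_upd phi z t : row phi (upd z ord0 t) = row phi z.
Proof. by apply: eq_map => i; rewrite /blank updK. Qed.

Lemma lifted_upd phi z t :
  lifted phi (upd z ord0 t) = density (@bern R d) (@dual R d) (row phi z) t.
Proof. by rewrite /lifted row_upd upd_same. Qed.

Lemma uniq_others : uniq (ord0 :: others).
Proof.
rewrite /= map_inj_uniq ?enum_uniq ?andbT; last exact: lift_inj.
by apply/mapP => -[i _ /eqP]; rewrite (negPf (neq_lift _ _)).
Qed.

Definition cube_avg phi (z0 z1 : input) : R :=
  `|avg (fun t => \prod_(p <- cube others z0 z1) lifted phi (upd p ord0 t))|.

Lemma cube_avgE phi z0 z1 : cube_avg phi z0 z1 =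
  `|avg (fun t => \prod_(r <- map (row phi) (cube others z0 z1))
       density (@bern R d) (@dual R d) r t)|.
Proof.
congr `| _ |; apply: eq_avg => t; rewrite big_map; apply: eq_bigr => p _.
exact: lifted_upd.
Qed.

(** Exhibits all positions of a cube as values of [phi] at an explicit list of points, so that
    [avg_dups_le] applies. *)
Lemma flatten_rows phi z0 z1 :
  flatten (map (row phi) (cube others z0 z1)) =
  positions iota phi [seq (p, i) | p <- cube others (blank z0) z1, i <- enum 'I_m].
Proof.
rewrite /positions map_allpairs /blank cube_updl ?allpairs_mapl//.
by have /andP[] := uniq_others.
Qed.

Lemma size_others : size others = k.
Proof. by rewrite size_map size_enum_ord. Qed.

Lemma cube_avg_le phi z0 z1 : cube_avg phi z0 z1 <= 2 ^+ (K * m).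
Proof.
rewrite cube_avgE; apply: (le_trans (ler_norm_avg _)).
set rows := map _ _.
apply: (le_trans (y := avg (fun t => \prod_(r <- rows)
    `|density (@bern R d) (@dual R d) r t|))).
  by apply: ler_avg => t; rewrite normr_prod.
apply: (le_trans (avg_prod_norm_density_le _ _ _ _)).
- exact: bern_ge0.
- exact: bern_sum.
- by rewrite sum_norm_dual.
rewrite ler_weXn2l ?ler1n// (leq_trans (dups_le_size _))// flatten_rows.
by rewrite size_map size_allpairs size_cube size_others size_enum_ord.
Qed.

(** The vertices of a nondegenerate cube are distinct, so the K m values of [phi] involved are
    independent and 32 to the number of coincidences has mean at most 2^K. Dividing by 4^(d K)
    leaves at most 2^(-d K). *)
Lemma avg_cube_avg_le z0 z1 : {in others, forall i, z0 i != z1 i} ->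
  avg (fun phi => cube_avg phi z0 z1) <= (2 ^+ (d * K))^-1.
Proof.
move=> ne; set L := [seq (p, i) | p <- cube others (blank z0) z1, i <- enum 'I_m].
have sL : size L = (K * m)%N.
  by rewrite size_allpairs size_cube size_others size_enum_ord.
have /andP[ord0N u_others] := uniq_others.
have uL : uniq L.
  apply: allpairs_uniq; last by move=> [? ?] [? ?] _ _ /= [-> ->].
    apply: uniq_cube => // i io; rewrite upd_other ?ne//.
    by apply: contraTneq io => ->.
  exact: enum_uniq.
(* The base 32 comes from [norm_avg_prod_density_le] and K m counts the positions; [KB] is what
   makes m x at most 1/2, whence (1 + x)^m <= 2. *)
pose x : R := 32 * (K * m)%:R / B%:R.
have x0 : 0 <= x by rewrite divr_ge0// mulr_ge0.
have mx : m%:R * x <= 2^-1.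
  rewrite /x mulrA ler_pdivrMr ?ltr0n// ler_pdivlMl//.
  rewrite -!natrM ler_nat; apply: leq_trans KB; nia.
have h : avg (fun phi => cube_avg phi z0 z1 * 4 ^+ (d * K)) <= 2 ^+ K.
  apply: (le_trans (y := avg (fun phi => 32 ^+ dups (positions iota phi L)))).
    apply: ler_avg => phi; rewrite -flatten_rows cube_avgE.
    rewrite -[X in (d * X)%N](_ : size (map (row phi) (cube others z0 z1)) = _);
      last by rewrite size_map size_cube size_others.
    apply: norm_avg_prod_density_le.
    - exact: bern_ge0.
    - exact: bern_sum.
    - by rewrite sum_norm_dual.
    - exact: dual_orth.
    by apply/allP => _ /mapP[p _ ->]; exact: uniq_row.
  apply: (le_trans (y := (1 + x) ^+ size L)).
    by apply: avg_dups_le; rewrite ?sL.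
  rewrite sL mulnC exprM; apply: lerXn2r; rewrite ?nnegrE ?exprn_ge0 ?addr_ge0//.
  by apply: (le_trans (expr1D_le x0 mx)); move: mx; rewrite -mulrA; lra.
rewrite -(ler_pM2r (_ : 0 < 4 ^+ (d * K))) ?exprn_gt0// -avgZr.
apply: (le_trans h); have -> : 4 = 2 * 2 :> R by ring.
rewrite exprMn mulKf ?expf_neq0// ?pnatr_eq0// ler_weXn2l ?ler1n// leq_pmull//.
Qed.

Lemma avg_eq_coord i : avg (fun z0 => avg (fun z1 : input => (z0 i == z1 i)%:R)) =
  (2 ^+ n)^-1 :> R.
Proof.
have cT : #|{:n.-tuple bool}| = (2 ^ n)%N by rewrite card_tuple card_bool.
have T0 : (0 < #|{:n.-tuple bool}|)%N by rewrite cT expn_gt0.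
rewrite (@eq_avg _ _ _ (fun=> (2 ^+ n)^-1)) ?avg_cst ?card_ffun_gt0//.
move=> z0; rewrite (avg_resample T0 i).
rewrite (@eq_avg _ _ _ (fun=> (2 ^+ n)^-1)) ?avg_cst ?card_ffun_gt0//.
move=> z1; rewrite (@eq_avg _ _ _ (fun t => (z0 i == t)%:R)); last first.
  by move=> t; rewrite upd_same.
rewrite /avg cT (bigD1 (z0 i))//= eqxx big1 ?addr0 ?mulr1 ?natrX// => t.
by rewrite eq_sym => /negPf->.
Qed.

(* A cube is degenerate with probability at most [k / 2 ^ n], too rarely for the
   trivial bound on its contribution to matter. *)
Lemma exists_selection : exists phi,
  avg (fun z0 => avg (fun z1 => cube_avg phi z0 z1)) <= 2 / 2 ^+ (d * K).
Proof.
have cB : (0 < #|'I_B|)%N by rewrite card_ord.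
have T0 : (0 < #|{:n.-tuple bool}|)%N by rewrite card_tuple card_bool expn_gt0.
have Z0 : (0 < #|{:input}|)%N by exact: card_ffun_gt0.
pose V phi := avg (fun z0 => avg (fun z1 => cube_avg phi z0 z1)).
have [phi le_phi] := @avg_exists_le R _ V (card_ffun_gt0 cB).
exists phi; apply: (le_trans le_phi); rewrite /V avg_exchange.
apply: (le_trans (y := avg (fun z0 => avg (fun z1 => (2 ^+ (d * K))^-1 +
    2 ^+ (K * m) * \sum_(i <- others) (z0 i == z1 i)%:R)))).
  apply: ler_avg => z0; rewrite avg_exchange; apply: ler_avg => z1.
  have s0 : 0 <= \sum_(i <- others) (z0 i == z1 i)%:R :> R by rewrite sumr_ge0.
  have [/hasP[i io /eqP zi]|/hasPn ne] := boolP (has (fun i => z0 i == z1 i) others).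
    apply: (le_trans (y := 2 ^+ (K * m))).
      apply: (le_trans (ler_avg (cube_avg_le ^~ _ ^~ _))).
      by rewrite avg_cst ?card_ffun_gt0.
    rewrite -[leLHS]add0r lerD ?invr_ge0 ?exprn_ge0// ler_peMr ?exprn_ge0//.
    rewrite (big_rem i)//= zi eqxx lerDl; apply: sumr_ge0 => j _; exact: ler0n.
  apply: (le_trans (avg_cube_avg_le ne)); rewrite lerDl mulr_ge0 ?exprn_ge0//.
have -> : avg (fun z0 => avg (fun z1 : input => (2 ^+ (d * K))^-1 +
    2 ^+ (K * m) * \sum_(i <- others) (z0 i == z1 i)%:R)) =
    (2 ^+ (d * K))^-1 + 2 ^+ (K * m) * (k%:R / 2 ^+ n) :> R.
  under eq_avg do rewrite avgD avg_cst// avgZl avg_sum.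
  rewrite avgD avg_cst// avgZl avg_sum; congr (_ + _ * _).
  under eq_bigr do rewrite avg_eq_coord.
  by rewrite big_const_seq count_predT size_others iter_addr_0 mulr_natl.
have -> : 2 / 2 ^+ (d * K) = (2 ^+ (d * K))^-1 + (2 ^+ (d * K))^-1 :> R.
  by rewrite -[RHS]mulr2n -[RHS]mulr_natl.
rewrite lerD2l mulrA ler_pdivrMr ?exprn_gt0// [leRHS]mulrC ler_pdivlMr ?exprn_gt0//.
rewrite -!natrX -!natrM ler_nat.
(* Since k <= 2^k, it is enough to compare exponents: K m + k + d K <= m B <= n. *)
apply: (@leq_trans (2 ^ (K * m + k + d * K))).
  by rewrite !expnD leq_mul2r leq_mul2l ltnW ?orbT// ltn_expl.
rewrite leq_exp2l//; apply: leq_trans mB.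
have kK : (k <= K)%N by rewrite ltnW// ltn_expl.
have K0 : (0 < K)%N by rewrite expn_gt0.
have m0 : (0 < m)%N := leq_trans d_gt0 dm.
apply: (@leq_trans (m * (64 * K * m ^ 2))); last by rewrite leq_mul2l KB orbT.
have : (K * m <= K * m * (m * m))%N by rewrite leq_pmulr// muln_gt0 m0.
have : (d * K <= K * m)%N by rewrite mulnC leq_mul2l dm orbT.
have : (K <= K * m)%N by rewrite leq_pmulr.
have -> : (m * (64 * K * m ^ 2) = 64 * (K * m * (m * m)))%N by ring.
lia.
Qed.

End Lifted_density.

(** * Protocols *)

Section Protocol_correlation.
Context {R : realType} {n k : nat}.
Notation input := {ffun 'I_k -> n.-tuple bool}.
Implicit Types (z : input) (chi : 'I_k -> input -> bool).

Definition cylinder chi := forall i z t, chi i (upd z i t) = chi i z.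

Lemma see_upd i z t : see i (upd z i t) = see i z.
Proof. by apply/ffunP => j; rewrite !ffunE (negPf (valP j)). Qed.

Definition correlation (g : input -> R) chi : R :=
  `|avg (fun z => g z * \prod_i (chi i z)%:R)|.

(** The bit written by player i depends on the view of i only, so its indicator can be absorbed into
    the i-th cylinder. *)
Lemma correlation_Say_branch i (f : view n i -> bool) b (g : input -> R) M chi :
  (forall chi, cylinder chi -> correlation g chi <= M) -> cylinder chi ->
  correlation (fun z => (f (see i z) == b)%:R * g z) chi <= M.
Proof.
move=> gM cyl; pose chi' j z := chi j z && ((j == i) ==> (f (see i z) == b)).
apply: le_trans (gM chi' _); last first.
  move=> j z t; rewrite /chi' cyl; case: (eqVneq j i) => [->|//].
  by rewrite see_upd.
rewrite le_eqVlt; apply/orP; left; apply/eqP; congr `| _ |; apply: eq_avg => z.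
under [in RHS]eq_bigr do rewrite /chi' -mulnb natrM.
rewrite big_split /= [X in _ = _ * (_ * X)](bigD1 i)//= eqxx /=.
rewrite [X in _ = _ * (_ * (_ * X))]big1 ?mulr1; first by ring.
by move=> j /negPf->.
Qed.

(** Each bit splits the inputs into two branches and at most doubles the bound; along a path to a
    leaf only a cylinder intersection remains. *)
Lemma correlation_run (P : protocol k n) (g : input -> R) M chi :
  (forall chi, cylinder chi -> correlation g chi <= M) -> cylinder chi ->
  correlation (fun z => (run P z)%:R * g z) chi <= 2 ^+ cost P * M.
Proof.
move=> gM; have M0 : 0 <= M.
  by apply: le_trans (gM (fun _ _ => true) _) => //; exact: normr_ge0.
elim: P chi => [b|i f P1 IH1 P0 IH0] chi cyl /=.
  rewrite mul1r; case: b; last first.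
    by rewrite /correlation (@eq_avg _ _ _ (fun=> 0 * 0)) ?avgZl ?mul0r ?normr0// => z;
      rewrite !mul0r.
  apply: le_trans (gM _ cyl); rewrite le_eqVlt; apply/orP; left; apply/eqP.
  by congr `| _ |; apply: eq_avg => z; rewrite mul1r.
have h b Q : (cost Q <= maxn (cost P1) (cost P0))%N ->
    (forall chi, cylinder chi ->
      correlation (fun z => (run Q z)%:R * g z) chi <= 2 ^+ cost Q * M) ->
    correlation (fun z => (f (see i z) == b)%:R * ((run Q z)%:R * g z)) chi <=
    2 ^+ maxn (cost P1) (cost P0) * M.
  move=> Qc IH; apply: (le_trans (y := 2 ^+ cost Q * M)).
    exact: (@correlation_Say_branch i f b (fun z => (run Q z)%:R * g z)).
  by rewrite ler_wpM2r// ler_weXn2l// ler1n.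
have := lerD (h true P1 (leq_maxl _ _) IH1) (h false P0 (leq_maxr _ _) IH0).
rewrite -mulr2n -[leRHS]mulr_natl exprS -mulrA; apply: le_trans.
apply: le_trans (ler_normD _ _); rewrite -avgD.
rewrite le_eqVlt; apply/orP; left; apply/eqP; congr `| _ |; apply: eq_avg => z.
by case: (f _); rewrite /= !(mul0r, mul1r, addr0, add0r).
Qed.

Definition accept (P : rand_protocol R k n) z : R :=
  \sum_(r : coins P | run (det_of P r) z) weight P r.

Lemma acceptE (P : rand_protocol R k n) z :
  accept P z = \sum_r weight P r * (run (det_of P r) z)%:R.
Proof.
rewrite /accept big_mkcond; apply: eq_bigr => r _.
by case: (run _ _); rewrite ?mulr1 ?mulr0.
Qed.

Lemma accept_ge0 (P : rand_protocol R k n) z : 0 <= accept P z.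
Proof. by apply: sumr_ge0 => r _; exact: weight_ge0. Qed.

Lemma error_accept (P : rand_protocol R k n) (G : boolfun k n) z :
  error P G z = if G z then 1 - accept P z else accept P z.
Proof.
rewrite /error /accept -(weight_sum1 P); case: (G z); last first.
  by apply: eq_bigl => r; case: (run _ _).
rewrite [X in _ = X - _](bigID (fun r => run (det_of P r) z)) /= addrAC subrr add0r.
by apply: eq_bigl => r; case: (run _ _).
Qed.

(* A power of the acceptance probability is the probability that independent
   runs all accept. *)
Lemma correlation_acceptX (P : rand_protocol R k n) c r (h : input -> R) M chi :
  (forall r, (cost (det_of P r) <= c)%N) ->
  (forall chi, cylinder chi -> correlation h chi <= M) -> cylinder chi ->
  correlation (fun z => h z * accept P z ^+ r) chi <= 2 ^+ (r * c) * M.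
Proof.
move=> Pc hM; have M0 : 0 <= M.
  by apply: le_trans (hM (fun _ _ => true) _) => //; exact: normr_ge0.
elim: r chi => [|r IH] chi cyl.
  rewrite mul0n expr0 mul1r; apply: le_trans (hM _ cyl).
  rewrite le_eqVlt; apply/orP; left; apply/eqP.
  by congr `| _ |; apply: eq_avg => z; rewrite expr0 mulr1.
rewrite /correlation (@eq_avg _ _ _ (fun z => \sum_s weight P s *
  ((run (det_of P s) z)%:R * (h z * accept P z ^+ r) * \prod_i (chi i z)%:R))).
  rewrite avg_sum; apply: (le_trans (ler_norm_sum _ _ _)).
  apply: (le_trans (y := \sum_s weight P s * (2 ^+ (r.+1 * c) * M))); last first.
    by rewrite -mulr_suml weight_sum1 mul1r.
  apply: ler_sum => s _; rewrite avgZl normrM ger0_norm ?weight_ge0//.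
  rewrite ler_wpM2l ?weight_ge0//.
  apply: (le_trans (correlation_run _ IH cyl)).
  by rewrite mulSn exprD -mulrA ler_wpM2r ?mulr_ge0 ?exprn_ge0// ler_weXn2l// ler1n.
move=> z; rewrite exprS {1}acceptE !mulr_suml mulr_sumr mulr_suml.
by apply: eq_bigr => s _; ring.
Qed.

Lemma accept_error (P : rand_protocol R k n) (G : boolfun k n) z :
  error P G z <= 3^-1 ->
  if G z then 2 / 3 <= accept P z else accept P z <= 3^-1.
Proof. by rewrite error_accept; case: (G z) => //; lra. Qed.

(* [h] plays the role of the dual witness: it is positive on the inputs Merlin
   must convince Arthur of, and it correlates with no cheap protocol. *)
Lemma MA_correlation (G : boolfun k n) (h : input -> R) M c1 c2 r
    (P : c1.-tuple bool -> rand_protocol R k n) :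
  (forall z, G z -> 0 <= h z) ->
  avg (fun z => `|h z|) <= 1 ->
  (forall chi, cylinder chi -> correlation h chi <= M) ->
  (forall w s, (cost (det_of (P w) s) <= c2)%N) -> MA_computes P G ->
  avg (fun z => h z * (G z)%:R) * (2 / 3) ^+ r - 2 ^+ c1 * 3^-1 ^+ r <=
  2 ^+ c1 * (2 ^+ (r * c2) * M).
Proof.
move=> h_ge0 h1 hM Pc PG; pose A z := \sum_w accept (P w) z ^+ r.
have cw : #|{:c1.-tuple bool}| = (2 ^ c1)%N by rewrite card_tuple card_bool.
have A0 z : 0 <= A z by apply: sumr_ge0 => w _; rewrite exprn_ge0// accept_ge0.
apply: (le_trans (y := avg (fun z => h z * A z))); last first.
  apply: (le_trans (ler_norm _)).
  rewrite (@eq_avg _ _ _ (fun z => \sum_w h z * accept (P w) z ^+ r)); last first.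
    by move=> z; rewrite mulr_sumr.
  rewrite avg_sum; apply: (le_trans (ler_norm_sum _ _ _)).
  apply: (le_trans (y := \sum_(w : c1.-tuple bool) 2 ^+ (r * c2) * M)); last first.
    by rewrite sumr_const cw -[leLHS]mulr_natl natrX.
  apply: ler_sum => w _.
  have := @correlation_acceptX (P w) c2 r h M (fun _ _ => true) (Pc w) hM.
  move=> /(_ (fun _ _ _ => erefl)); apply: le_trans.
  rewrite le_eqVlt; apply/orP; left; apply/eqP.
  by congr `| _ |; apply: eq_avg => z; rewrite big1 ?mulr1.
have e3 : 0 <= 2 ^+ c1 * 3^-1 ^+ r :> R by rewrite mulr_ge0// exprn_ge0.
apply: (le_trans (y := avg (fun z => h z * (G z)%:R * (2 / 3) ^+ r) -
    2 ^+ c1 * 3^-1 ^+ r * avg (fun z => `|h z|))).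
  by rewrite avgZr lerB// ler_piMr.
rewrite -avgZl -mulN1r -avgZl -avgD; apply: ler_avg => z.
have := PG z; have [Gz [w /accept_error]|Gz all_w] := boolP (G z).
  rewrite Gz mulr1 mulN1r => acc.
  apply: (le_trans (y := h z * (2 / 3) ^+ r)).
    by rewrite gerBl mulr_ge0.
  rewrite ler_wpM2l ?h_ge0// /A (bigD1 w)//=.
  apply: (le_trans (lerXn2r r _ _ acc)); rewrite ?nnegrE ?accept_ge0//.
  by rewrite lerDl sumr_ge0// => v _; rewrite exprn_ge0// accept_ge0.
rewrite mulr0 mul0r add0r mulN1r.
apply: (le_trans (y := - (A z * `|h z|))); last first.
  rewrite lerNl -mulNr mulrC ler_wpM2l// -normrN; exact: ler_norm.
rewrite lerN2 ler_wpM2r//.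
apply: (le_trans (y := \sum_(w : c1.-tuple bool) 3^-1 ^+ r)); last first.
  by rewrite sumr_const cw -[leLHS]mulr_natl natrX.
apply: ler_sum => w _; apply: lerXn2r; rewrite ?nnegrE ?accept_ge0//.
by have := accept_error (all_w w); rewrite (negPf Gz).
Qed.

End Protocol_correlation.

(** * The selected disjunction and its Merlin-Arthur cost *)

Section Selected_disjunction.
Context {R : realType} {n k d m B : nat}.
Notation input := {ffun 'I_k.+1 -> n.-tuple bool}.
Variable iota : 'I_m * 'I_B -> 'I_n.
Hypothesis iota_inj : injective iota.
Hypothesis d_gt0 : (0 < d)%N.
Hypothesis mE : m = (d ^ 2 * (4 * d + 2))%N.
Variable phi : {ffun input * 'I_m -> 'I_B}.

Definition selected_or : boolfun k.+1 n :=
  fun z => has (tnth (z ord0)) (row iota phi z).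

Notation h := (lifted (R := R) (d := d) iota phi).

Lemma density_zero (s : seq 'I_n) x : ~~ has (tnth x) s ->
  density (@bern R d) (@dual R d) s x =
  2 ^+ size s * \sum_(j < (2 * d).+1) dual j * bern j false ^+ size s.
Proof.
move=> /hasPn x0; rewrite mulr_sumr; apply: eq_bigr => j _; rewrite mulrCA.
congr (_ * _); rewrite -exprMn -iter_mulr_1 -count_predT -big_const_seq.
rewrite big_seq [RHS]big_seq; apply: eq_bigr => p /x0/negPf->.
by [].
Qed.

(** With all selected bits 0, the density is 2^m times the mass of the zero string, which is
    positive by [dual_zero_mass]. *)
Lemma lifted_ge0 z : negf selected_or z -> 0 <= h z.
Proof.
move=> z0; rewrite /lifted density_zero// mulr_ge0// size_row.
by apply: le_trans (dual_zero_mass d_gt0 mE); rewrite invr_ge0.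
Qed.

Let T_gt0 : (0 < #|{:n.-tuple bool}|)%N.
Proof. by rewrite card_tuple card_bool expn_gt0. Qed.

Lemma avg_norm_lifted_le1 : avg (fun z => `|h z|) <= 1.
Proof.
rewrite (avg_resample T_gt0 ord0).
apply: (le_trans (y := avg (fun _ : input => 1))); last first.
  by rewrite avg_cst// card_ffun_gt0.
apply: ler_avg => z.
rewrite (@eq_avg _ _ _ (fun t => \prod_(r <- [:: row iota phi z])
   `|density (@bern R d) (@dual R d) r t|)); last first.
  by move=> t; rewrite big_seq1 lifted_upd.
apply: (le_trans (avg_prod_norm_density_le _ _ _ _)).
- exact: bern_ge0.
- exact: bern_sum.
- by rewrite sum_norm_dual.
by rewrite /= cats0 dups_uniq// uniq_row.
Qed.

(** The factor 2^m of the density on the zero string turns the indicator of that string into the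
    density of a point mass, which integrates to 1. *)
Lemma avg_lifted_zero :
  avg (fun z => h z * (negf selected_or z)%:R) =
  \sum_(j < (2 * d).+1) dual j * bern j false ^+ m :> R.
Proof.
rewrite (avg_resample T_gt0 ord0) -[RHS](@avg_cst _ {:input}) ?card_ffun_gt0//.
apply: eq_avg => z; set mass := \sum_j _; set r := row iota phi z.
pose w (b : bool) : R := (~~ b)%:R.
rewrite (@eq_avg _ _ _ (fun t => (\prod_(p <- r) (2 * w (tnth t p))) * mass)).
  by rewrite avg_bits_density ?avg_cst// ?uniq_row// /w add0r.
move=> t; rewrite lifted_upd /negf /selected_or row_upd upd_same -/r.
have [z1|z0] /= := boolP (has _ _).
  have /hasP[p pr tp] := z1.
  by rewrite mulr0 (big_rem p)//= tp /w /= mulr0 !mul0r.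
rewrite density_zero// mulr1 size_row; congr (_ * _).
rewrite -(size_row iota phi z) -iter_mulr_1 -count_predT -big_const_seq.
rewrite big_seq [RHS]big_seq; apply: eq_bigr => p pr.
by rewrite /w (negPf (hasPn z0 _ pr)) mulr1.
Qed.

(** This is the K-th root of [cylinder_discrepancy], with player 0 as the coordinate never doubled;
    2 <= 2^K absorbs the constant. *)
Lemma correlation_lifted_le chi :
  avg (fun z0 => avg (fun z1 => cube_avg (R := R) (d := d) iota phi z0 z1)) <=
    2 / 2 ^+ (d * 2 ^ k) ->
  cylinder chi -> correlation h chi <= 2 / 2 ^+ d.
Proof.
move=> small cyl.
have b0 : 0 <= 2 / 2 ^+ d :> R by rewrite divr_ge0// exprn_ge0.
rewrite -(@ler_pXn2r _ (2 ^ k)) ?nnegrE ?expn_gt0//; last exact: normr_ge0.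
pose c i (z : input) : R := (chi i z)%:R.
have := @cylinder_discrepancy R _ _ T_gt0 ord0 (others (k := k)) h c (@uniq_others k).
move=> /(_ _ _)/wrap[].
- by move=> i z; rewrite /c; case: (chi i z); rewrite ?normr1 ?normr0.
- by move=> i _ z t; rewrite /c cyl.
rewrite size_others => disc.
apply: (le_trans (y := 2 / 2 ^+ (d * 2 ^ k))); last first.
  rewrite expr_div_n -exprM ler_wpM2r ?invr_ge0 ?exprn_ge0//.
  by rewrite ler_eXnr ?ler1n// expn_gt0.
apply: le_trans small; apply: le_trans disc.
rewrite le_eqVlt; apply/orP; left; apply/eqP; congr (`| _ | ^+ _).
apply: eq_avg => z; congr (_ * _).
by rewrite big_ord_recl big_cons big_map big_enum.
Qed.

Lemma MA_cost_selected_or c1 c2 e (P : c1.-tuple bool -> rand_protocol R k.+1 n) :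
  avg (fun z0 => avg (fun z1 => cube_avg (R := R) (d := d) iota phi z0 z1)) <=
    2 / 2 ^+ (d * 2 ^ k) ->
  (forall w s, (cost (det_of (P w) s) <= c2)%N) ->
  MA_computes P (negf selected_or) -> (4 * d + 2 <= 2 ^ e)%N ->
  (d <= (c1 + 1 + e) * (c2 + 3))%N.
Proof.
(* For this r, 2^(-e) (2/3)^r is exactly twice 2^(c1) 3^(-r), so half of the gain survives the
   loss. *)
move=> small Pc PG de; set r := (c1 + 1 + e)%N.
have := @MA_correlation R n k.+1 _ h _ c1 c2 r P lifted_ge0 avg_norm_lifted_le1
  (fun chi => @correlation_lifted_le chi small) Pc PG.
rewrite avg_lifted_zero => main.
have mass : (2 ^+ e)^-1 <= \sum_(j < (2 * d).+1) dual j * bern j false ^+ m :> R.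
  apply: le_trans (dual_zero_mass d_gt0 mE).
  rewrite lef_pV2 ?posrE ?exprn_gt0 ?ltr0n ?addn_gt0 ?orbT//.
  by rewrite -natrX ler_nat.
have p3 : 0 <= (2 / 3) ^+ r :> R by rewrite exprn_ge0// divr_ge0.
(* Weakening 3^(-r) to 4^(-r) leaves powers of two only; their exponents give d <= r (c2 + 2) +
   1. *)
have e1 : 2 ^+ c1 * (4 ^+ r)^-1 <= 2 ^+ c1 * (2 ^+ (r * c2) * (2 / 2 ^+ d)) :> R.
  apply: le_trans main; apply: (le_trans (y := 2 ^+ c1 * 3^-1 ^+ r)).
    rewrite ler_wpM2l ?exprn_ge0// -exprVn; apply: lerXn2r;
    rewrite ?nnegrE ?invr_ge0//; lra.
  rewrite lerBrDr; apply: le_trans (ler_wpM2r p3 mass).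
  have e0 : 2 ^+ e != 0 :> R by rewrite expf_neq0.
  have -> : (2 ^+ e)^-1 * (2 / 3) ^+ r = 2 * (2 ^+ c1 * 3^-1 ^+ r) :> R.
    by rewrite exprMn !mulrA; congr (_ * _); rewrite /r !exprD expr1; field.
  lra.
move: e1; rewrite ler_pM2l ?exprn_gt0// mulrA ler_pdivlMr ?exprn_gt0//.
rewrite mulrC ler_pdivrMr ?exprn_gt0// (_ : 4 = 2 ^+ 2); last by ring.
rewrite -exprSr -exprM -exprD ler_eXn2l ?ltr1n// => dle.
apply: leq_trans dle _; rewrite /r; nia.
Qed.

(** Completes the view of player 0 by a zero string; since [row] ignores that string, player 0 can
    compute the selected positions. *)
Definition unsee (v : view n (ord0 : 'I_k.+1)) : input :=
  [ffun j => if insub j is Some j' then v j' else [tuple false | i < n]].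

Lemma unsee_see z : unsee (see ord0 z) = blank z.
Proof.
apply/ffunP => j; rewrite !ffunE; case: insubP => [j' jN0 jE|].
  by rewrite ffunE jE (negPf jN0).
by rewrite negbK => /eqP->; rewrite eqxx.
Qed.

End Selected_disjunction.

Section Nondeterministic_cost.
Context {n k m B : nat}.
Notation input := {ffun 'I_k.+2 -> n.-tuple bool}.
Variable iota : 'I_m * 'I_B -> 'I_n.
Variable phi : {ffun input * 'I_m -> 'I_B}.

(* The guess [p] is checked by player 0, who can compute the selected
   positions, and the bit at [p] is then announced by player 1. *)
Lemma nondet_selected_or : (0 < n)%N ->
  nondet_costs (selected_or iota phi) (up_log 2 n + 2)%N.
Proof.
move=> n_gt0; set c := up_log 2 n.
(* Strings of rank n or more decode to position 0; this is harmless, as every guess is checked. *)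
pose dec (w : c.-tuple bool) : 'I_n := nth (Ordinal n_gt0) (enum 'I_n) (enum_rank w).
have decP p : exists w, dec w = p.
  have pc : (p < #|{:c.-tuple bool}|)%N.
    by rewrite card_tuple card_bool (leq_trans (ltn_ord p))// up_logP.
  exists (enum_val (Ordinal pc)); apply: val_inj.
  by rewrite /dec enum_valK /= nth_enum_ord.
pose j0 : {j : 'I_k.+2 | j != lift ord0 ord0} := Sub ord0 isT.
pose P w : protocol k.+2 n :=
  Say (fun v : view n (ord0 : 'I_k.+2) => dec w \in row iota phi (unsee v))
    (Say (fun v : view n (lift ord0 ord0) => tnth (v j0) (dec w))
      (Output _ _ true) (Output _ _ false)) (Output _ _ false).
have runE w z : run (P w) z = (dec w \in row iota phi z) && tnth (z ord0) (dec w).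
  rewrite /= unsee_see row_upd ffunE /=.
  by case: (_ \in _) => //=; case: (tnth _ _).
exists c, 2%N; split=> //; exists P; split=> // z.
have [/hasP[p pr zp]|z0] := boolP (selected_or iota phi z).
  by have [w wE] := decP p; exists w; rewrite runE wE pr zp.
move=> w; rewrite runE; apply: contraNF z0 => /andP[pr zp].
by apply/hasP; exists (dec w).
Qed.

End Nondeterministic_cost.

(* [d = s ^ 4] leaves room for [(c + O(s)) ^ 2 < d] whenever [c <= s]. *)
Lemma exists_hard_function (R : realType) (n k s : nat) :
  (12 <= s)%N -> (2 ^ k.+1 * s ^ 42 <= n)%N ->
  exists F : boolfun k.+2 n, nondet_costs F (up_log 2 n + 2)%N /\
    forall c, MA_costs R (negf F) c -> (s < c)%N.
Proof.
move=> s12 sn; pose d := (s ^ 4)%N; pose m := (d ^ 2 * (4 * d + 2))%N.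
pose B := (n %/ m)%N.
have d_gt0 : (0 < d)%N by rewrite expn_gt0 (leq_trans _ s12).
have dm : (d <= m)%N by rewrite /m; clearbody d; clear -d_gt0; nia.
have m_gt0 := leq_trans d_gt0 dm.
have mB : (m * B <= n)%N by rewrite mulnC leq_divM.
(* The exponent 42 arises here: 4 m <= 24 d^3 <= s^14 because 24 <= 12^2 <= s^2, and 64 m^3 = (4
   m)^3. *)
have KB : (64 * 2 ^ k.+1 * m ^ 2 <= B)%N.
  rewrite leq_divRL//; apply: leq_trans sn.
  rewrite [X in (X <= _)%N](_ : _ = 2 ^ k.+1 * (4 * m) ^ 3)%N; last by ring.
  rewrite leq_mul2l (expnM s 14 3) leq_exp2r//; apply/orP; right.
  apply: (@leq_trans (24 * d ^ 3)); first by rewrite /m; nia.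
  rewrite -expnM (expnD s 2 12) leq_mul2r; apply/orP; right.
  by apply: leq_trans (leq_mul s12 s12).
have [iota iota_inj] : exists iota : 'I_m * 'I_B -> 'I_n, injective iota.
  have le : (#|{: 'I_m * 'I_B}| <= n)%N by rewrite card_prod !card_ord.
  exists (fun e => widen_ord le (enum_rank e)) => x y /(congr1 val) /= /val_inj.
  exact: enum_rank_inj.
have [phi small] := @exists_selection R n k.+1 d m B iota iota_inj d_gt0 dm mB KB.
have n_gt0 : (0 < n)%N.
  by apply: leq_trans sn; rewrite muln_gt0 !expn_gt0 (leq_trans _ s12).
exists (selected_or iota phi); split; first exact: nondet_selected_or.
move=> _ [c1 [c2 [-> [P [Pc PG]]]]]; rewrite ltnNge; apply/negP => cs.
have de : (4 * d + 2 <= 2 ^ (4 * s + 3))%N.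
  have : (s ^ 4 < (2 ^ s) ^ 4)%N by rewrite ltn_exp2r// ltn_expl.
  by rewrite -expnM [(s * 4)%N]mulnC expnD /d; clear -s12; lia.
have := MA_cost_selected_or iota_inj d_gt0 erefl small Pc PG de.
apply/negP; rewrite -ltnNge.
(* A cost of at most s makes both factors at most 11 s, and 121 s^2 < s^4 because s >= 12. *)
apply: (@leq_ltn_trans ((11 * s) * (11 * s))); first by rewrite leq_mul//; clear -cs s12; lia.
rewrite mulnACA (_ : d = s * s * (s * s))%N; last by rewrite /d; ring.
by rewrite ltn_mul2r muln_gt0 (leq_trans _ s12)//= (leq_trans _ (leq_mul s12 s12)).
Qed.

(** * Asymptotics *)

Section Logarithms.
Context {R : realType}.

Let ln2_gt0 : 0 < ln 2 :> R. Proof. by rewrite ln_gt0// ltr1n. Qed.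

Lemma powR_log2 (x : R) : 0 < x -> 2 `^ log2 x = x.
Proof.
by move=> x0; rewrite /powR pnatr_eq0/= /log2 divfK ?gt_eqF// lnK.
Qed.

Lemma le_log2_expn2 (j n : nat) : (2 ^ j <= n)%N -> j%:R <= log2 (n%:R : R).
Proof.
move=> jn; have n0 : (0 < n)%N by apply: leq_trans jn; rewrite expn_gt0.
rewrite ler_pdivlMr// mulr_natl -lnXn// ler_ln ?posrE ?exprn_gt0 ?ltr0n//.
by rewrite -natrX ler_nat.
Qed.

Lemma up_log2_le (n : nat) : (1 < n)%N ->
  (up_log 2 n + 2)%:R <= 4 * log2 (n%:R : R).
Proof.
move=> n1; have h1 : 1 <= log2 (n%:R : R) by exact: (@le_log2_expn2 1).
have := @le_log2_expn2 (up_log 2 n).-1 n (ltnW (up_log_gtn _ n1)) => /(_ isT).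
have u0 : (0 < up_log 2 n)%N by rewrite up_log_gt0.
by rewrite -{2}(prednK u0) natrD -natr1; lra.
Qed.

Lemma log2_ge_near (M : R) : \forall n \near \oo, M <= log2 (n%:R : R).
Proof.
exists (Num.truncn (expR (M * ln 2))).+1 => // n /= nM.
have h : expR (M * ln 2) <= n%:R.
  by apply: ltW; apply: lt_le_trans (truncnS_gt _) _; rewrite ler_nat.
rewrite ler_pdivlMr// -ler_expR lnK// posrE.
by apply: lt_le_trans h; exact: expR_gt0.
Qed.

(** With l = log2 n, n^delta = exp(a l) exceeds its Taylor term of order e + 1, which is at least
    l^e once l >= (e + 1)!/a^(e + 1). *)
Lemma log2X_lt_powR (delta : R) e : 0 < delta ->
  \forall n \near \oo, log2 (n%:R : R) ^+ e < n%:R `^ delta.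
Proof.
move=> delta0; pose a := delta * ln 2.
have a0 : 0 < a by rewrite mulr_gt0.
pose f : R := e.+1`!%:R; have f0 : 0 < f by rewrite ltr0n fact_gt0.
near=> n.
have lM : Num.max 1 (f / a ^+ e.+1) <= log2 n%:R by near: n; exact: log2_ge_near.
set l := log2 _ in lM *.
have l1 : 1 <= l by apply: le_trans lM; rewrite le_max lexx.
have l2 : f / a ^+ e.+1 <= l by apply: le_trans lM; rewrite le_max lexx orbT.
have n0 : (0 < n)%N.
  rewrite lt0n; apply: contraTneq l1 => n0.
  by rewrite /l n0 /log2 ln0// mul0r -ltNge.
have -> : n%:R `^ delta = expR (a * l).
  rewrite /powR pnatr_eq0 eqn0Ngt n0 /=; congr expR.
  by rewrite /a /l /log2 -mulrA [ln 2 * _]mulrC divfK ?gt_eqF.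
clearbody l; have al0 : 0 <= a * l by rewrite mulr_ge0// ltW// (lt_le_trans ltr01).
apply: lt_le_trans (expR_ge1Dxn e al0).
rewrite -/f exprMn [l ^+ e.+1]exprSr.
apply: (le_lt_trans (y := a ^+ e.+1 * (l ^+ e * l) / f)).
  rewrite ler_pdivlMr// [leRHS]mulrCA ler_wpM2l ?exprn_ge0 ?(le_trans ler01)//.
  by rewrite mulrC -ler_pdivrMr ?exprn_gt0.
by rewrite ltrDr.
Unshelve. all: by end_near. Qed.

End Logarithms.

Section Determinism.
Context {R : realType} {k n : nat}.

Lemma unit_weight_sum : \sum_(u : unit) (1 : R) = 1.
Proof. by rewrite sumr_const card_unit. Qed.

Definition det_rand (P : protocol k n) : rand_protocol R k n :=
  @RandProtocol R k n unit (fun=> 1) (fun=> ler01) unit_weight_sum (fun=> P).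

Lemma error_det_rand P G x : run P x = G x -> error (det_rand P) G x = 0.
Proof. by move=> PG; apply: big_pred0 => u /=; rewrite PG eqxx. Qed.

Lemma MAcc_le_Ncc (G : boolfun k n) : (MAcc R G <= Ncc R G)%E.
Proof.
apply: ereal_inf_le_tmp => _ [c [c1 [c2 [-> [P [Pc PG]]]]] <-] /=.
exists (c1 + c2)%N => //; exists c1, c2; split=> //.
exists (fun w => det_rand (P w)); split => [w r|x]; first exact: Pc.
have err w : run (P w) x = G x -> error (det_rand (P w)) G x <= 3^-1.
  by move=> /error_det_rand->; rewrite invr_ge0.
by have := PG x; case: ifP => _ => [[w /err]|PG0 w]; [exists w|exact/err].
Qed.

End Determinism.

(** * Cost bounds for large n and separation of the classes *)

Lemma hard_function_near (R : realType) (eps : R) : 0 < eps ->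
  exists (C delta : R) (n0 : nat), [/\ 0 < C, 0 < delta &
     forall n k : nat, (n0 <= n)%N -> (1 <= k)%N ->
       k%:R <= (1 - eps) * log2 (n%:R : R) ->
       exists F : boolfun k.+1 n,
         (Ncc R F <= (C * log2 (n%:R : R))%:E)%E /\
         ((n%:R `^ delta)%:E <= MAcc R (negf F))%E].
Proof.
(* For s the integer part of n^delta, s^42 <= n^eps is needed, and 42/50 < 1. *)
move=> eps0; pose delta := eps / 50.
have delta0 : 0 < delta by rewrite divr_gt0.
exists 4, delta, (maxn 2 (Num.truncn (12 `^ delta^-1 : R)).+1); split=> // n [//|k].
rewrite geq_max => /andP[n2 nd] _ kn.
have n0 : 0 < n%:R :> R by rewrite ltr0n ltnW.
have big : 12 <= n%:R `^ delta.
  have : 12 `^ delta^-1 <= n%:R :> R.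
    by apply: ltW; apply: lt_le_trans (truncnS_gt _) _; rewrite ler_nat.
  move=> /(ge0_ler_powR (ltW delta0)); rewrite -powRrM mulVf ?gt_eqF// powRr1//.
  by apply; rewrite nnegrE ?powR_ge0.
pose s := Num.truncn (n%:R `^ delta).
have s12 : (12 <= s)%N by rewrite truncn_ge_nat// powR_ge0.
have /andP[sn ns] := truncn_itv (powR_ge0 n%:R delta).
have size_n : (2 ^ k.+1 * s ^ 42 <= n)%N.
  rewrite -(ler_nat R) natrM !natrX.
  apply: (le_trans (y := n%:R `^ (1 - eps) * n%:R `^ eps)); last first.
    by rewrite -powRD ?subrK ?powRr1// gt_eqF// implybT.
  rewrite ler_pM ?exprn_ge0//.
    rewrite -powR_mulrn// -{1}(powR_log2 n0) -powRrM ler_powR ?ler1n//.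
    by rewrite mulrC.
  apply: (le_trans (lerXn2r 42 _ _ sn)); rewrite ?nnegrE ?powR_ge0//.
  rewrite -powR_mulrn ?powR_ge0// -powRrM ler_powR ?ler1n ?(ltnW n2)//.
  by rewrite /delta; lra.
have [F [FN FMA]] := exists_hard_function R s12 size_n.
exists F; split.
  apply: (le_trans (y := ((up_log 2 n + 2)%:R)%:E)).
    by apply: ereal_inf_lbound; exists (up_log 2 n + 2)%N.
  by rewrite lee_fin up_log2_le.
apply: le_ereal_inf_tmp => _ [c /FMA sc <-]; rewrite lee_fin.
(* The strict bound s < c absorbs the rounding: n^delta < s + 1 <= c. *)
by apply: (le_trans (ltW ns)); rewrite ler_nat.
Qed.

(** The witness is the family of the functions -F. Both classes depend on large n only, so the
    remaining lengths may receive a constant function. *)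
Lemma class_separation (R : realType) (C delta : R) (n0 : nat) (k : nat -> nat)
    (P : nat -> Prop) :
  0 < delta -> (\forall n \near \oo, P n) ->
  (forall n, (n0 <= n)%N -> P n -> exists F : boolfun (k n) n,
    (Ncc R F <= (C * log2 (n%:R : R))%:E)%E /\
    ((n%:R `^ delta)%:E <= MAcc R (negf F))%E) ->
  exists2 G, coNP_class R k G & ~ MA_class R k G.
Proof.
move=> delta0 nearP exF.
have exG n : exists G : boolfun (k n) n, (n0 <= n)%N -> P n ->
    (Ncc R (negf G) <= (C * log2 (n%:R : R))%:E)%E /\
    ((n%:R `^ delta)%:E <= MAcc R G)%E.
  have [[nn Pn]|no] := pselect ((n0 <= n)%N /\ P n).
    have [F [FN FMA]] := exF n nn Pn; exists (negf F) => _ _; split=> //.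
    by rewrite (_ : negf (negf F) = F)//; apply/funext => x; exact: negbK.
  by exists (fun=> false) => nn Pn; case: no.
pose G n := sval (cid (exG n)); have GP n := svalP (cid (exG n)).
have near_n0 : \forall n \near \oo, (n0 <= n)%N by exists n0.
exists G.
  (* Exponent 2 absorbs the constant: C log n <= (log n)^2 as soon as log n >= C. *)
  exists 2%N; near=> n.
  have [||GN _] := GP n; [by near: n|by near: n|].
  apply: (le_trans GN); rewrite lee_fin expr2.
  have : Num.max 0 C <= log2 n%:R by near: n; exact: log2_ge_near.
  by rewrite ge_max => /andP[l0 lC]; rewrite ler_wpM2r.
move=> [e le_e]; near \oo => n.
have [||_ GMA] := GP n; [by near: n|by near: n|].
have : (MAcc R (G n) <= (log2 n%:R ^+ e)%:E)%E by near: n.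
move=> /(le_trans GMA); rewrite lee_fin leNgt => /negP; apply.
by near: n; exact: log2X_lt_powR.
Unshelve. all: by end_near. Qed.

Lemma NP_subset_MA (R : realType) (k : nat -> nat) : NP_class R k `<=` MA_class R k.
Proof.
move=> G [e le_e]; exists e; apply: filterS le_e => n.
exact: le_trans (MAcc_le_Ncc _).
Qed.

Theorem theorem5p5 (R : realType) (eps : R) (eps_gt0 : 0 < eps) :
  (exists (C delta : R) (n0 : nat), [/\ 0 < C, 0 < delta &
     forall n k : nat, (n0 <= n)%N -> (1 <= k)%N ->
       k%:R <= (1 - eps) * log2 (n%:R : R) ->
       exists F : boolfun k.+1 n,
         (Ncc R F <= (C * log2 (n%:R : R))%:E)%E /\
         ((n%:R `^ delta)%:E <= MAcc R (negf F))%E])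
  /\
  (forall k : nat -> nat,
     (\forall n \near \oo,
        (2 <= k n)%N /\ (k n)%:R <= (1 - eps) * log2 (n%:R : R)) ->
     ~ (coNP_class R k `<=` MA_class R k) /\
     NP_class R k <> coNP_class R k).
Proof.
have hard := hard_function_near eps_gt0; split=> // k near_k.
have [C [delta [n0 [_ delta0 exF]]]] := hard.
have [G GcoNP GMA] : exists2 G, coNP_class R k G & ~ MA_class R k G.
  apply: (class_separation (n0 := n0) (C := C) delta0 near_k) => n nn [].
  (* With j + 1 players in all, the bound is needed for j only. *)
  case: (k n) => [//|j] j1 jle; apply: exF => //.
  by apply: le_trans jle; rewrite ler_nat.
split=> [/(_ G GcoNP)//|NPcoNP]; apply: GMA.
by apply: NP_subset_MA; rewrite NPcoNP.
Qed.
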